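(* Let $R\subset\mathbb R^N$ be a root system with multiplicity function $k\ge0$. Let $(X_t^\lambda)_{t\ge0}$ be either a Dunkl process on $\mathbb R^N$ of type $R$ with multiplicity $k$, regular drift $\lambda\in\mathbb R^N$ and arbitrary starting point $x\in\mathbb R^N$, or a Bessel process on the closed Weyl chamber $C$ of type $R$ with multiplicity $k$, regular drift $\lambda\in C$ and arbitrary starting point $x\in C$. Then $X_t^\lambda/t\to\lambda$ in probability as $t\to\infty$.
   Context: Let $N\ge1$ and let $\mathbb R^N$ carry the usual scalar product $\langle\cdot,\cdot\rangle$ and norm $\|\cdot\|$. A root system $R$ is a finite set of vectors in $\mathbb R^N\setminus\{0\}$ such that the reflections $\sigma_\alpha$ on the hyperplanes $\alpha^\perp$ ($\alpha\in R$) generate a finite group $W$ of orthogonal transformations and $\sigma_\alpha(R)=R$ for all $\alpha\in R$. Fix a positive subsystem $R_+\subset R$ and the associated closed Weyl chamber $C=\{x\in\mathbb R^N:\langle x,\alpha\rangle\ge0\ \text{for all }\alpha\in R_+\}$. A multiplicity function is a $W$-invariant map $k:R\to[0,\infty)$. A vector $\lambda\in\mathbb R^N$ is regular if it does not lie in the boundary of a Weyl chamber, i.e. $\langle\alpha,\lambda\rangle\ne0$ for all $\alpha\in R$. The Dunkl operators are $T_\xi(k)f(x)=\partial_\xi f(x)+\sum_{\alpha\in R_+}k(\alpha)\langle\alpha,\xi\rangle\frac{f(x)-f(\sigma_\alpha(x))}{\langle\alpha,x\rangle}$. The Dunkl kernel $E_k:\mathbb C^N\times\mathbb C^N\to\mathbb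 C$ is characterized by the property that for each $w\in\mathbb C^N$ the function $f=E_k(\cdot,w)$ is the unique holomorphic solution of $T_\xi(k)f=\langle\xi,w\rangle f$ for all $\xi\in\mathbb C^N$ with $f(0)=1$ (here $\langle\cdot,\cdot\rangle$ is extended bilinearly); one has $E_k(x,y)>0$ for $x,y\in\mathbb R^N$. The associated Bessel function is $J_k(z,w)=\frac1{|W|}\sum_{g\in W}E_k(z,gw)$. Put $w_k(x)=\prod_{\alpha\in R_+}|\langle\alpha,x\rangle|^{2k(\alpha)}$, $\gamma=\sum_{\alpha\in R_+}k(\alpha)$, and $c_k=\left(\int_{\mathbb R^N}e^{-\|y\|^2/2}w_k(y)\,dy\right)^{-1}$. The Dunkl process of type $R$ with multiplicity $k$ and drift $\lambda$ is the Feller process on $\mathbb R^N$ (with RCLL paths) having transition probabilities $$K_t^{\lambda,k,Dunkl}(x,A)=\frac{c_k e^{-\|\lambda\|^2t/2}}{t^{\gamma+N/2}}\int_A e^{-(\|x\|^2+\|y\|^2)/(2t)}\,\frac{E_k\left(\frac{x}{\sqrt t},\frac{y}{\sqrt t}\right)E_k(y,\lambda)}{E_k(x,\lambda)}\,w_k(y)\,dy$$ for $t>0$, $x\in\mathbb R^N$ and Borel sets $A\subset\mathbb R^N$. The Bessel process of type $R$ with multiplicity $k$ and drift $\lambda\in C$ is the Feller diffusion on $C$ (with continuous paths) having transition probabilities $$K_t^{\lambda,k}(x,A)=\frac{|W|\,c_k\,e^{-\|\lambda\|^2t/2}}{t^{\gamma+N/2}}\int_A e^{-(\|x\|^2+\|y\|^2)/(2t)}\,\frac{J_k\left(\frac{x}{\sqrt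 t},\frac{y}{\sqrt t}\right)J_k(y,\lambda)}{J_k(x,\lambda)}\,w_k(y)\,dy$$ for $t>0$, $x\in C$ and Borel sets $A\subset C$. *)

(* Defs.v *)
From HB Require Import structures.
From mathcomp Require Import all_boot all_order all_algebra finmap complex.
From mathcomp Require Import all_classical all_reals all_analysis measurable_realfun.
Import numFieldNormedType.Exports.
Set Implicit Arguments. Unset Strict Implicit. Unset Printing Implicit Defensive.
Import Order.TTheory GRing.Theory Num.Theory.
Local Open Scope classical_set_scope.
Local Open Scope ring_scope.
HB.instance Definition _ (R : realType) n :=
  Measurable.copy 'rV[R]_n (g_sigma_algebraType (@open 'rV[R]_n)).

Section lebesgue_rV.
Variable R : realType.

Definition rV_cons n (p : measurableTypeR R * 'rV[R]_n) : 'rV[R]_n.+1 :=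
  row_mx (p.1)%:M p.2.

Definition rV_uncons n (v : 'rV[R]_n.+1) : measurableTypeR R * 'rV[R]_n :=
  (v 0 ord0, \row_j v 0 (lift ord0 j)).

Lemma rV_cons0 n p : @rV_cons n p 0 ord0 = p.1.
Proof.
rewrite /rV_cons (_ : ord0 = lshift n (ord0 : 'I_1)); last exact/val_inj.
by rewrite (@row_mxEl _ _ 1 n) mxE eqxx mulr1n.
Qed.

Lemma rV_consS n p j : @rV_cons n p 0 (lift ord0 j) = p.2 0 j.
Proof.
rewrite /rV_cons (_ : lift ord0 j = rshift 1 j); last exact/val_inj.
by rewrite (@row_mxEr _ _ 1 n).
Qed.

Lemma rV_consK n : cancel (@rV_cons n) (@rV_uncons n).
Proof.
move=> [x v]; rewrite /rV_uncons rV_cons0; congr pair.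
by apply/rowP => j; rewrite mxE rV_consS.
Qed.

Lemma rV_unconsK n : cancel (@rV_uncons n) (@rV_cons n).
Proof.
move=> v; apply/rowP => i.
by have [j ->|->] := unliftP ord0 i; rewrite ?rV_consS ?rV_cons0 //= mxE.
Qed.

Lemma open_measurable_rV n (U : set 'rV[R]_n) : open U -> measurable U.
Proof. by move=> oU; exact: sub_sigma_algebra. Qed.

Lemma measurable_rV_cons n : measurable_fun setT (@rV_cons n).
Proof.
apply: (@measurability _ _ _ _ setT _ (@open 'rV[R]_n.+1)) => //.
move=> _ [U oU <-]; rewrite setTI.
pose B (i : rat * 'rV[rat]_n * nat) : set (measurableTypeR R * 'rV[R]_n) :=
  ball (ratr i.1.1 : R) (i.2.+1%:R^-1) `*`
  (ball (map_mx ratr i.1.2 : 'rV[R]_n) (i.2.+1%:R^-1)).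
pose D := [set i | B i `<=` @rV_cons n @^-1` U].
have -> : @rV_cons n @^-1` U = \bigcup_(i in D) B i.
  apply/seteqP; split; last by move=> p [i Di Bp]; exact: Di.
  move=> p /= Up.
  have /nbhs_ballP[e e0 eU] : nbhs (rV_cons p) U by exact: open_nbhs_nbhs.
  pose k := Num.truncn (2 / e).
  pose d : R := k.+1%:R^-1.
  have d0 : 0 < d by rewrite invr_gt0.
  have de : d + d < e.
    have /andP[_] := truncn_itv (divr_ge0 (ler0n R 2) (ltW e0)).
    rewrite ltr_pdivrMr// -/k -ltr_pdivrMl// => h.
    by rewrite -mulr2n -mulr_natr.
  have rd (x : R) : {q : rat | `|x - ratr q| < d}.
    apply: cid.
    have /rat_in_itvoo[q] : x - d < x + d by rewrite ltrD2l gt0_cp.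
    by rewrite in_itv/= -ltr_distlC => h; exists q.
  pose q := projT1 (rd p.1).
  pose w := \row_j projT1 (rd (p.2 0 j)).
  exists (q, w, k).
  - move=> r /= [/= qr [_ wr]]; apply: eU; split => // i j; rewrite ord1 {i}.
    rewrite /ball/=; apply: lt_trans de.
    have [j' ->|->] := unliftP ord0 j.
      rewrite !rV_consS -(subrK (ratr (w 0 j')) (p.2 0 j')) -addrA.
      rewrite (le_lt_trans (ler_normD _ _))// ltrD//.
        by rewrite mxE; exact: (projT2 (rd _)).
      by have := wr 0 j'; rewrite mxE.
    rewrite !rV_cons0 -(subrK (ratr q) p.1) -addrA.
    by rewrite (le_lt_trans (ler_normD _ _))// ltrD//; exact: (projT2 (rd _)).
  - split => /=.
      by rewrite /ball/= distrC; exact: (projT2 (rd _)).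
    split => // i j; rewrite !mxE ord1 /ball/= distrC; exact: (projT2 (rd _)).
rewrite bigcup_mkcond; apply: countable_bigcupT_measurable => // i.
case: ifPn => // _; apply: measurableX; first exact: measurable_ball.
by apply: open_measurable_rV; exact: ball_open.
Qed.

Lemma continuous_measurable_rV n (f : 'rV[R]_n -> R) :
  continuous f -> measurable_fun [set: 'rV[R]_n] (f : _ -> measurableTypeR R).
Proof.
move=> cf; apply: (measurability _ (RGenOpens.measurableE R)).
move=> _ [_ [a [b ->]] <-]; rewrite setTI; apply: open_measurable_rV.
apply: open_comp; last exact: interval_open.
by move=> x _; exact: cf.
Qed.

Lemma measurable_rV_uncons n : measurable_fun setT (@rV_uncons n).
Proof.
apply: measurable_fun_pair.
  by apply: continuous_measurable_rV; exact: coord_continuous.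
apply: (@measurability _ _ _ _ setT _ (@open 'rV[R]_n)) => //.
move=> _ [U oU <-]; rewrite setTI; apply: open_measurable_rV.
apply: open_comp => // v _.
move=> /= W /nbhs_ballP[e e0 eW]; apply/nbhs_ballP; exists e => //= u [_ vu].
by apply: eW; split => // i j; rewrite !mxE; exact: vu.
Qed.

Section cons_measure.
Variables (n : nat) (nu : {sigma_finite_measure set (measurableTypeR R) -> \bar R})
  (mu : {sigma_finite_measure set 'rV[R]_n -> \bar R}).

Definition cons_measure : set 'rV[R]_n.+1 -> \bar R :=
  pushforward (nu \x mu)%E (@rV_cons n).

Let mcons A : measurable A -> measurable (@rV_cons n @^-1` A).
Proof.
by move=> mA; rewrite -[X in measurable X]setTI; exact: measurable_rV_cons.
Qed.

Let cons_measure0 : cons_measure set0 = 0%E.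
Proof. by rewrite /cons_measure /pushforward preimage_set0 measure0. Qed.

Let cons_measure_ge0 A : (0 <= cons_measure A)%E.
Proof. by rewrite /cons_measure /pushforward; exact: measure_ge0. Qed.

Let cons_measure_sigma_additive : semi_sigma_additive cons_measure.
Proof.
move=> F mF tF mUF; rewrite /cons_measure /pushforward preimage_bigcup.
apply: measure_semi_sigma_additive.
- by move=> k; exact: mcons.
- apply/trivIsetP => /= i j _ _ ij; rewrite -preimage_setI.
  by move/trivIsetP : tF => /(_ _ _ _ _ ij) ->//; rewrite preimage_set0.
- by rewrite -preimage_bigcup; exact: mcons.
Qed.

HB.instance Definition _ := isMeasure.Build _ _ _ cons_measure
  cons_measure0 cons_measure_ge0 cons_measure_sigma_additive.

Let cons_measure_sigma_finite : sigma_finite setT cons_measure.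
Proof.
have /sigma_finiteP[F [TF ndF Foo]] := sigma_finiteT nu.
have /sigma_finiteP[G [TG ndG Goo]] := sigma_finiteT mu.
exists (fun k => @rV_uncons n @^-1` (F k `*` G k)).
  rewrite -preimage_bigcup -[LHS](@preimage_setT _ _ (@rV_uncons n)).
  congr preimage; rewrite -setXTT TF TG predeqE => -[x y]; split.
    move=> [/= [i _ Fnx] [k _ Gky]]; exists (maxn i k) => //; split.
    - by move: x Fnx; exact/subsetPset/ndF/leq_maxl.
    - by move: y Gky; exact/subsetPset/ndG/leq_maxr.
  by move=> [i _ []/= ? ?]; split; exists i.
move=> k; have [mF Fk] := Foo k; have [mG Gk] := Goo k; split.
  rewrite -[X in measurable X]setTI; apply: measurable_rV_uncons => //.
  exact: measurableX.
rewrite /cons_measure /pushforward -comp_preimage.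
rewrite (_ : _ \o _ = id); last by apply/funext => p /=; rewrite rV_consK.
by rewrite preimage_id [ltLHS]product_measure1E// lte_mul_pinfty// ge0_fin_numE.
Qed.

HB.instance Definition _ := Measure_isSigmaFinite.Build _ _ _ cons_measure
  cons_measure_sigma_finite.

End cons_measure.

(* n-dimensional Lebesgue measure: the n-fold product of [lebesgue_measure],
   carried to row vectors; see [lebesgue_rV_box] *)
Fixpoint lebesgue_rV n : {sigma_finite_measure set 'rV[R]_n -> \bar R} :=
  match n with
  | 0 => dirac (0 : 'rV[R]_0)
  | m.+1 => cons_measure lebesgue_measure (lebesgue_rV m)
  end.

Lemma lebesgue_rV_box n (a b : 'I_n -> R) : (forall i, a i <= b i) ->
  lebesgue_rV n [set v | forall i, a i <= v 0 i <= b i] =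
    (\prod_i (b i - a i))%:E.
Proof.
elim: n a b => [a b _|n ih a b ab] /=.
  rewrite big_ord0 /dirac/= indicE mem_set// => -[].
  by move=> [].
rewrite /cons_measure /pushforward.
have mbox m (c d : 'I_m -> R) :
    measurable ([set v : 'rV[R]_m | forall i, c i <= v 0 i <= d i]).
  rewrite (_ : mkset _ =
    \bigcap_(i in [set: 'I_m]) ((fun v : 'rV[R]_m => v 0 i) @^-1` `[c i, d i])).
    apply: fin_bigcap_measurable => // i _.
    rewrite -[X in measurable X]setTI; apply: continuous_measurable_rV => //.
    exact: coord_continuous.
  apply/seteqP; split => v /= h i; first by move=> _; rewrite /= ?in_itv/=; exact: h.
  by have := h i Logic.I; rewrite /= ?in_itv.
rewrite (_ : _ @^-1` _ = `[a ord0, b ord0]%classic `*` [set v : 'rV[R]_n |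
   forall i, a (lift ord0 i) <= v 0 i <= b (lift ord0 i)]); last first.
  apply/seteqP; split => -[x v]/=.
    move=> h; split; first by have := h ord0; rewrite rV_cons0 /= ?in_itv.
    by move=> i; have := h (lift ord0 i); rewrite rV_consS.
  move=> [x01 h] i; have [j ->|->] := unliftP ord0 i.
    by rewrite rV_consS; exact: h.
  by rewrite rV_cons0/=; move: x01; rewrite /= ?in_itv.
rewrite [LHS]product_measure1E//.
rewrite ih; last by move=> i; exact: ab.
rewrite [X in (X * _)%E](lebesgue_measure_itv `[a ord0, b ord0])/= lte_fin.
rewrite big_ord_recl.
case: ltP => h; first by [].
by rewrite (le_anti (introT andP (conj (ab ord0) h))) subrr mul0r mul0e.
Qed.

End lebesgue_rV.

(* the topology of C given by the modulus *)
HB.instance Definition _ (R : realType) := NormedModule.copy R[i] R[i]^o.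

Section euclidean.
Variable R : realType.

(* over the complex numbers this is the bilinear (not hermitian) extension *)
Definition dot (K : pzSemiRingType) n (x y : 'rV[K]_n) : K :=
  \sum_i x 0 i * y 0 i.

(* the library norm on ['rV[R]_n] is the sup norm *)
Definition enorm n (x : 'rV[R]_n) : R := Num.sqrt (dot x x).

Definition cplx m n (A : 'M[R]_(m, n)) : 'M[R[i]]_(m, n) :=
  map_mx (real_complex R) A.

End euclidean.

(* Vectors are rows and matrices act on the right: [g] maps [x] to [x *m g]. *)
Section root_systems.
Variables (R : realType) (N : nat).
Implicit Types (Phi Phip : {fset 'rV[R]_N}) (k : 'rV[R]_N -> R).

Definition reflection (a : 'rV[R]_N) : 'M[R]_N :=
  1%:M - (2 / dot a a) *: (a^T *m a).

Definition group_closed (G : set 'M[R]_N) : Prop :=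
  [/\ G 1%:M, (forall g h, G g -> G h -> G (g *m h)) &
      (forall g, G g -> G (invmx g))].

Definition weyl_group Phi : set 'M[R]_N :=
  smallest group_closed [set reflection a | a in [set` Phi]].

Definition root_system Phi : Prop :=
  [/\ 0 \notin Phi, finite_set (weyl_group Phi) &
      forall a, a \in Phi -> [fset b *m reflection a | b in Phi]%fset = Phi].

Definition positive_subsystem Phi Phip : Prop :=
  exists2 v : 'rV[R]_N, (forall a, a \in Phi -> dot a v != 0) &
    (forall a, (a \in Phip) = (a \in Phi) && (0 < dot a v)).

Definition weyl_chamber Phip : set 'rV[R]_N :=
  [set x | forall a, a \in Phip -> 0 <= dot x a].

Definition regular Phi (l : 'rV[R]_N) : Prop :=
  forall a, a \in Phi -> dot a l != 0.

(* only the values of [k] on [Phi] matter *)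
Definition multiplicity Phi k : Prop :=
  forall a, a \in Phi ->
    0 <= k a /\ (forall g, weyl_group Phi g -> k (a *m g) = k a).

End root_systems.

Section dunkl_kernel.
Variables (R : realType) (N : nat).
Implicit Types (Phi Phip : {fset 'rV[R]_N}) (k : 'rV[R]_N -> R).
Implicit Types (f : 'rV[R[i]]_N -> R[i]) (E : 'rV[R[i]]_N -> 'rV[R[i]]_N -> R[i]).

(* (f(x) - f(s_a x)) / <a, x>, extended by continuity to the hyperplane
   <a, x> = 0 *)
Definition dunkl_quotient (a : 'rV[R]_N) f (x : 'rV[R[i]]_N) : R[i] :=
  let q y := (f y - f (y *m cplx (reflection a))) / dot (cplx a) y in
  if dot (cplx a) x != 0 then q x
  else lim (q y @[y --> within [set y | dot (cplx a) y != 0] (nbhs x)]).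

Definition dunkl_operator Phip k (xi : 'rV[R[i]]_N) f (x : 'rV[R[i]]_N) : R[i] :=
  'D_xi f x +
  \sum_(a <- Phip) (k a)%:C%C * dot (cplx a) xi * dunkl_quotient a f x.

(* [differentiable] is over the field C here, so the first condition says that
   [f] is holomorphic on C^N *)
Definition dunkl_eigenfunction Phip k (w : 'rV[R[i]]_N) f : Prop :=
  [/\ (forall z : 'rV[R[i]]_N, differentiable f z),
      (forall xi z, dunkl_operator Phip k xi f z = dot xi w * f z) &
      f 0 = 1].

Definition is_dunkl_kernel Phip k E : Prop :=
  forall w, dunkl_eigenfunction Phip k w (E ^~ w) /\
    (forall f, dunkl_eigenfunction Phip k w f -> f = E ^~ w).

Definition bessel_function Phi E (z w : 'rV[R[i]]_N) : R[i] :=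
  (#|` fset_set (weyl_group Phi)|%:R)^-1 *
  \sum_(g <- fset_set (weyl_group Phi)) E z (w *m cplx g).

(* E_k and J_k are real-valued on R^N x R^N, so taking real parts only changes
   the type *)
Definition on_reals E (x y : 'rV[R]_N) : R := complex.Re (E (cplx x) (cplx y)).

Definition weight Phip k (x : 'rV[R]_N) : R :=
  \prod_(a <- Phip) `|dot a x| `^ (2 * k a).

Definition gamma Phip k : R := \sum_(a <- Phip) k a.

Definition dunkl_constant Phip k : R :=
  (\int[lebesgue_rV R N]_y (expR (- (enorm y ^+ 2 / 2)) * weight Phip k y))^-1.

(* the common shape of the densities of the two transition kernels: [F] is E_k
   or J_k restricted to R^N x R^N, [c] is c_k or |W| c_k *)
Definition drift_density Phip k (c : R) (F : 'rV[R]_N -> 'rV[R]_N -> R)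
    (l : 'rV[R]_N) (t : R) (x y : 'rV[R]_N) : R :=
  c * expR (- (enorm l ^+ 2 * t / 2)) / t `^ (gamma Phip k + N%:R / 2) *
  (expR (- ((enorm x ^+ 2 + enorm y ^+ 2) / (2 * t))) *
   (F ((Num.sqrt t)^-1 *: x) ((Num.sqrt t)^-1 *: y) * F y l / F x l) *
   weight Phip k y).

Definition dunkl_density Phip k E :=
  drift_density Phip k (dunkl_constant Phip k) (on_reals E).

Definition bessel_density Phi Phip k E :=
  drift_density Phip k
    (#|` fset_set (weyl_group Phi)|%:R * dunkl_constant Phip k)
    (on_reals (bessel_function Phi E)).

End dunkl_kernel.

(* Markov processes on a Borel set [S] of R^N, for transition probabilities
   given by densities [p t x] with respect to Lebesgue measure (t > 0) *)
Section feller_processes.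
Variables (R : realType) (N : nat).
Variables (S : set 'rV[R]_N) (p : R -> 'rV[R]_N -> 'rV[R]_N -> R).

Definition transition (t : R) (x : 'rV[R]_N) (A : set 'rV[R]_N) : \bar R :=
  (\int[lebesgue_rV R N]_(y in A) (p t x y)%:E)%E.

Definition vanishing_continuous (f : 'rV[R]_N -> R) : Prop :=
  {within S, continuous f} /\
  (forall e, 0 < e -> exists r, forall x, S x -> r < enorm x -> `|f x| < e).

Definition semigroup (t : R) (f : 'rV[R]_N -> R) (x : 'rV[R]_N) : R :=
  \int[lebesgue_rV R N]_(y in S) (f y * p t x y).

Record feller_semigroup : Prop := {
  transition_ge0 : forall t x A, 0 < t -> S x -> measurable A -> A `<=` S ->
    (0 <= transition t x A)%E ;
  transition_total : forall t x, 0 < t -> S x -> transition t x S = 1%E ;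
  chapman_kolmogorov : forall s t x A, 0 < s -> 0 < t -> S x ->
    measurable A -> A `<=` S ->
    transition (s + t) x A =
      (\int[lebesgue_rV R N]_(y in S) (transition t y A * (p s x y)%:E))%E ;
  semigroup_C0 : forall t f, 0 < t -> vanishing_continuous f ->
    vanishing_continuous (semigroup t f) ;
  semigroup_strong : forall f, vanishing_continuous f ->
    forall e, 0 < e ->
      \forall t \near 0^'+, forall x, S x -> `|semigroup t f x - f x| < e
}.

Variables (d : measure_display) (Omega : measurableType d).
Variables (P : probability Omega R) (X : R -> Omega -> 'rV[R]_N).

Definition past (s : R) : set (set Omega) :=
  <<s [set X u @^-1` D | u in `[0, s]%classic & D in @measurable _ 'rV[R]_N] >>.

(* only the values [X t] for t >= 0 matter; the last field says that, for s >= 0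
   and t > 0, K_t(X_s, A) is the conditional probability of X_{s+t} \in A given
   the past up to s *)
Record feller_process (x : 'rV[R]_N) : Prop := {
  process_semigroup : feller_semigroup ;
  process_measurable : forall t, 0 <= t -> measurable_fun setT (X t) ;
  process_state : forall t w, 0 <= t -> S (X t w) ;
  process_start : {ae P, forall w, X 0 w = x} ;
  process_markov : forall s t A B, 0 <= s -> 0 < t ->
    measurable A -> A `<=` S -> past s B ->
    P (B `&` X (s + t) @^-1` A) =
      (\int[P]_(w in B) transition t (X s w) A)%E
}.

Definition rcll_paths : Prop := forall w t, 0 <= t ->
  X u w @[u --> t^'+] --> X t w /\ (0 < t -> cvg (X u w @[u --> t^'-])).

Definition continuous_paths : Prop :=
  forall w, {within `[0, +oo[, continuous (X ^~ w)}.

End feller_processes.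

Section statement_notions.
Variables (R : realType) (N : nat).
Variables (Phi Phip : {fset 'rV[R]_N}) (k : 'rV[R]_N -> R).
Variable E : 'rV[R[i]]_N -> 'rV[R[i]]_N -> R[i].
Variables (d : measure_display) (Omega : measurableType d).
Variables (P : probability Omega R).
Implicit Types (X : R -> Omega -> 'rV[R]_N) (l x : 'rV[R]_N).

Definition dunkl_process l x X : Prop :=
  feller_process setT (dunkl_density Phip k E l) P X x /\ rcll_paths X.

Definition bessel_process l x X : Prop :=
  feller_process (weyl_chamber Phip) (bessel_density Phi Phip k E l) P X x /\
  continuous_paths X.

Definition cvg_in_probability (Y : R -> Omega -> 'rV[R]_N) l : Prop :=
  forall e, 0 < e -> P [set w | e < enorm (Y t w - l)] @[t --> +oo] --> 0%E.

End statement_notions.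

(* Main.v *)
(* Write E for the Dunkl kernel restricted to real vectors. Along the rays
   s |-> s x g (g in W) the Dunkl equation in the radial direction becomes the
   finite system
     u_g' = <x g, w> u_g - (1/s) sum_{a > 0} k_a (u_g - u_{g sigma_a}),
   u_g(0) = 1, to which a maximum principle applies. It shows that E >= 0 and
   that E(x, .) is locally Lipschitz, and it identifies E(c x, w) with
   E(x, c w) and E(x g, w g) with E(x, w).

   Let G be E or the Bessel function, and Z = X_t / t. Conservativeness of the
   semigroup for all t and all starting points says that, for the process started
   at 0, E_0 G(x, Z) = exp(|x|^2 / 2t) G(x, l), and that
   E_0 exp(|Z|^2 / 2) -> exp(|l|^2 / 2). The latter leaves no room for
   fluctuations as soon as Z points to l on average:
   - for the Dunkl process, expanding E(x, Z) to first order at x = 0 gives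
     E_0 <Z, l> = |l|^2, and exp(u) >= 1 + u gives E_0 |Z - l|^2 -> 0;
   - for the Bessel process, <y g, l> <= <y, l> on the chamber bounds the radial
     derivative of J(., l) by <y, l> J, and a rescaling of Lebesgue measure gives
     E_0 exp <Z, l> >= exp |l|^2, to be compared with
     exp <z, l> = exp((|z|^2 + |l|^2 - |z - l|^2) / 2).
   The law of Z from x has density exp(-|x|^2 / 2t) G(x, z) / G(x, l) with respect
   to its law from 0, and this density tends to 1 near z = l. *)
Require Import Defs.
From mathcomp Require Import all_boot all_order all_algebra finmap complex.
From mathcomp Require Import all_classical all_reals all_analysis measurable_realfun.
From mathcomp Require Import ring lra.
Import numFieldNormedType.Exports.
Import Order.TTheory GRing.Theory Num.Theory.
Local Open Scope classical_set_scope.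
Local Open Scope ring_scope.
Set Implicit Arguments. Unset Strict Implicit. Unset Printing Implicit Defensive.

(** * Euclidean geometry and root systems *)

Section euclidean_geometry.
Variables (R : realType) (N : nat).
Implicit Types (x y z a b : 'rV[R]_N) (g h : 'M[R]_N).

Lemma dotE x y : dot x y = (x *m y^T) 0 0.
Proof. by rewrite /dot mxE; apply: eq_bigr => i _; rewrite !mxE. Qed.

Lemma dotC x y : dot x y = dot y x.
Proof. by rewrite /dot; apply: eq_bigr => i _; rewrite mulrC. Qed.

Lemma dotDl x y z : dot (x + y) z = dot x z + dot y z.
Proof. by rewrite !dotE mulmxDl mxE. Qed.

Lemma dotZl (c : R) x y : dot (c *: x) y = c * dot x y.
Proof. by rewrite !dotE -scalemxAl mxE. Qed.

Lemma dotZr (c : R) x y : dot x (c *: y) = c * dot x y.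
Proof. by rewrite dotC dotZl dotC. Qed.

Lemma dotNl x y : dot (- x) y = - dot x y.
Proof. by rewrite !dotE mulNmx mxE. Qed.

Lemma dotBl x y z : dot (x - y) z = dot x z - dot y z.
Proof. by rewrite dotDl dotNl. Qed.

Lemma dotDr x y z : dot x (y + z) = dot x y + dot x z.
Proof. by rewrite !(dotC x) dotDl. Qed.

Lemma dotNr x y : dot x (- y) = - dot x y.
Proof. by rewrite !(dotC x) dotNl. Qed.

Lemma dotBr x y z : dot x (y - z) = dot x y - dot x z.
Proof. by rewrite dotDr dotNr. Qed.

Lemma dot0l x : dot 0 x = 0.
Proof. by rewrite dotE mul0mx mxE. Qed.

Lemma dot0r x : dot x 0 = 0.
Proof. by rewrite dotC dot0l. Qed.

Lemma dot_suml (I : Type) (r : seq I) (P : pred I) (f : I -> 'rV[R]_N) y :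
  dot (\sum_(i <- r | P i) f i) y = \sum_(i <- r | P i) dot (f i) y.
Proof. exact: (big_morph (fun x => dot x y) (fun x z => dotDl x z y) (dot0l y)). Qed.

Lemma dot_ge0 x : 0 <= dot x x.
Proof. by rewrite sumr_ge0// => i _; rewrite -expr2 sqr_ge0. Qed.

Lemma dot_eq0 x : (dot x x == 0) = (x == 0).
Proof.
apply/eqP/eqP => [|->]; last by rewrite dot0l.
move=> /eqP; rewrite psumr_eq0; last by move=> i _; rewrite -expr2 sqr_ge0.
move=> /allP h; apply/rowP => i; rewrite mxE.
by have := h i (mem_index_enum _); rewrite /= -expr2 sqrf_eq0 => /eqP.
Qed.

Lemma dot_gt0 x : (0 < dot x x) = (x != 0).
Proof. by rewrite lt_neqAle dot_ge0 andbT eq_sym dot_eq0. Qed.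

Lemma enorm_ge0 x : 0 <= enorm x.
Proof. exact: sqrtr_ge0. Qed.

Lemma enorm_sqr x : enorm x ^+ 2 = dot x x.
Proof. by rewrite sqr_sqrtr// dot_ge0. Qed.

Lemma enorm0 : enorm (0 : 'rV[R]_N) = 0.
Proof. by rewrite /enorm dot0l sqrtr0. Qed.

Lemma enormZ (c : R) x : enorm (c *: x) = `|c| * enorm x.
Proof. by rewrite /enorm dotZl dotZr mulrA -expr2 sqrtrM ?sqr_ge0// sqrtr_sqr. Qed.

(** Cauchy-Schwarz: the squared length of [dot y y *: x - dot x y *: y] is [dot y y] times the Gram
    determinant of [x] and [y]. *)
Lemma dot_le_enorm x y : dot x y <= enorm x * enorm y.
Proof.
have [->|y0] := eqVneq y 0; first by rewrite dot0r mulr_ge0 ?enorm_ge0.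
have yy : 0 < dot y y by rewrite dot_gt0.
have [xy|/ltW xy] := lerP (dot x y) 0.
  by rewrite (le_trans xy)// mulr_ge0 ?enorm_ge0.
rewrite -(@ler_pXn2r _ 2) ?nnegrE ?mulr_ge0 ?enorm_ge0//.
rewrite exprMn !enorm_sqr -subr_ge0.
have := dot_ge0 (dot y y *: x - dot x y *: y).
rewrite !(dotBl, dotBr, dotZl, dotZr) (dotC y x).
rewrite (_ : _ - _ = dot y y * (dot x x * dot y y - dot x y ^+ 2)); last by ring.
by rewrite pmulr_rge0.
Qed.

Lemma normr_dot_le x y : `|dot x y| <= enorm x * enorm y.
Proof.
rewrite ler_norml dot_le_enorm andbT lerNl -dotNl.
by rewrite (le_trans (dot_le_enorm _ _))// -scaleN1r enormZ normrN1 mul1r.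
Qed.

Lemma dot_mulmx x y g : dot (x *m g) y = dot x (y *m g^T).
Proof. by rewrite !dotE trmx_mul trmxK mulmxA. Qed.

Lemma tr_reflection a : (reflection a)^T = reflection a.
Proof.
by rewrite /reflection linearB/= linearZ/= trmx1 trmx_mul trmxK.
Qed.

Lemma mul_reflection x a :
  x *m reflection a = x - (2 / dot a a * dot x a) *: a.
Proof.
rewrite /reflection mulmxBr mulmx1 -scalemxAr mulmxA; congr (_ - _).
rewrite -scalerA; congr (_ *: _).
by rewrite [x *m a^T]mx11_scalar mul_scalar_mx dotE.
Qed.

Lemma mul_reflection_self a : a != 0 -> a *m reflection a = - a.
Proof.
rewrite -dot_eq0 => a0; rewrite mul_reflection mulfVK//.
by rewrite scaler_nat mulr2n opprD addrA subrr add0r.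
Qed.

Lemma mulmx_inj (m : nat) (A B : 'M[R]_(N, m)) :
  (forall x, x *m A = x *m B) -> A = B.
Proof. by move=> h; apply/row_matrixP => i; rewrite !rowE. Qed.

Lemma reflectionK a : a != 0 -> reflection a *m reflection a = 1%:M.
Proof.
move=> a0; apply: mulmx_inj => x.
rewrite mulmx1 mulmxA (mul_reflection x) mulmxBl -scalemxAl.
by rewrite mul_reflection_self// scalerN opprK mul_reflection subrK.
Qed.

End euclidean_geometry.

(** * The Weyl group: orthogonality, action on roots, conjugation of reflections *)

Section weyl_groups.
Variables (R : realType) (N : nat) (Phi : {fset 'rV[R]_N}).
Hypothesis rs : root_system Phi.
Implicit Types (x y z a b : 'rV[R]_N) (g h : 'M[R]_N).

Lemma root_neq0 a : a \in Phi -> a != 0.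
Proof. by case: rs => h _ _; apply: contraTneq => ->. Qed.

Lemma weyl_group_ind (P : set 'M[R]_N) : Defs.group_closed P ->
  (forall a, a \in Phi -> P (reflection a)) -> weyl_group Phi `<=` P.
Proof. by move=> cP PR; apply: smallest_sub => // _ [a aPhi <-]; exact: PR. Qed.

Lemma weyl_group_reflection a : a \in Phi -> weyl_group Phi (reflection a).
Proof. by move=> aPhi P [_ sP]; apply: sP; exists a. Qed.

Lemma weyl_group1 : weyl_group Phi 1%:M.
Proof. by move=> P [[P1 _ _] _]. Qed.

Lemma weyl_groupM g h :
  weyl_group Phi g -> weyl_group Phi h -> weyl_group Phi (g *m h).
Proof. by move=> Wg Wh P PP; case: (PP) => -[_ PM _] _; apply: PM; [exact: Wg P PP|exact: Wh P PP]. Qed.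

Lemma weyl_group_orthogonal g : weyl_group Phi g -> g *m g^T = 1%:M.
Proof.
move: g; apply: weyl_group_ind.
  split => [|g h /= gg hh|g /= gg] /=.
  - by rewrite trmx1 mulmx1.
  - by rewrite trmx_mul mulmxA -(mulmxA g) hh mulmx1.
  - have ug : g \in unitmx by case/mulmx1_unit: gg.
    have -> : invmx g = g^T by rewrite -[LHS]mulmx1 -gg mulmxA mulVmx// mul1mx.
    by rewrite trmxK; exact: mulmx1C.
by move=> a aPhi /=; rewrite tr_reflection reflectionK// root_neq0.
Qed.

Lemma weyl_group_unit g : weyl_group Phi g -> g \in unitmx.
Proof. by move=> /weyl_group_orthogonal /mulmx1_unit[]. Qed.

Lemma weyl_group_inv g : weyl_group Phi g -> weyl_group Phi g^T.
Proof.
move=> Wg; have -> : g^T = invmx g.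
  rewrite -[RHS]mulmx1 -(weyl_group_orthogonal Wg) mulmxA mulVmx ?mul1mx//.
  exact: weyl_group_unit.
by move=> P PP; case: (PP) => -[_ _ PV] _; apply: PV; exact: Wg P PP.
Qed.

Lemma weyl_group_trK g : weyl_group Phi g -> g^T *m g = 1%:M.
Proof. by move=> /weyl_group_inv /weyl_group_orthogonal; rewrite trmxK. Qed.

Lemma dot_weyl_group x y g : weyl_group Phi g -> dot (x *m g) (y *m g) = dot x y.
Proof. by move=> Wg; rewrite dot_mulmx -mulmxA weyl_group_orthogonal// mulmx1. Qed.

Lemma enorm_weyl_group x g : weyl_group Phi g -> enorm (x *m g) = enorm x.
Proof. by move=> Wg; rewrite /enorm dot_weyl_group. Qed.

Lemma root_reflection a b : a \in Phi -> b \in Phi -> b *m reflection a \in Phi.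
Proof.
move=> aPhi bPhi; case: rs => _ _ /(_ a aPhi) <-.
by apply/imfsetP; exists b.
Qed.

Lemma root_weyl_group g a : weyl_group Phi g -> (a *m g \in Phi) = (a \in Phi).
Proof.
(* Invertibility is carried along in the induction because closure under [invmx] cancels [g] against
   its inverse. *)
move=> Wg; suff /(_ g Wg)[_ ->] : weyl_group Phi `<=`
    [set g | g \in unitmx /\ forall a, (a *m g \in Phi) = (a \in Phi)] by [].
move: g a Wg => _ _ _; apply: weyl_group_ind.
  split => [|g h /= [ug hg] [uh hh]|g /= [ug hg]] /=.
  - by split => [|a]; rewrite ?unitmx1// mulmx1.
  - by split => [|a]; rewrite ?unitmx_mul ?ug// mulmxA hh hg.
  - by split => [|a]; rewrite ?unitmx_inv// -hg -mulmxA mulVmx// mulmx1.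
move=> a aPhi /=; split.
  by have /mulmx1_unit[] := reflectionK (root_neq0 aPhi).
move=> b; apply/idP/idP => [h|]; last exact: root_reflection.
rewrite -[b]mulmx1 -(reflectionK (root_neq0 aPhi)) mulmxA.
exact: root_reflection.
Qed.

Lemma root_opp a : a \in Phi -> - a \in Phi.
Proof. by move=> aPhi; rewrite -mul_reflection_self ?root_neq0// root_reflection. Qed.

Lemma reflection_conj a h : h *m h^T = 1%:M ->
  reflection (a *m h) = h^T *m reflection a *m h.
Proof.
move=> hh; have hh' : h^T *m h = 1%:M by exact: mulmx1C.
rewrite /reflection dot_mulmx -mulmxA hh mulmx1 trmx_mul.
rewrite mulmxBr mulmxBl mulmx1 hh' -scalemxAr. 
congr (_ - _).
by rewrite -scalemxAl !mulmxA.
Qed.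

Lemma reflectionZ (c : R) a : c != 0 -> reflection (c *: a) = reflection a.
Proof.
move=> c0; rewrite /reflection dotZl dotZr.
rewrite (_ : (c *: a)^T = c *: a^T); last by rewrite linearZ.
rewrite -scalemxAl -scalemxAr.
rewrite !scalerA; congr (_ - _ *: _).
have [->|a0] := eqVneq (dot a a) 0; first by rewrite !mulr0 invr0 mulr0 !mul0r.
by field; apply/andP.
Qed.

Lemma reflectionN a : reflection (- a) = reflection a.
Proof. by rewrite -scaleN1r reflectionZ// oppr_eq0 oner_eq0. Qed.

End weyl_groups.

(** * Simple roots, the deletion condition, and the maximum of [<y g, l>] over the Weyl group *)

Section chamber_maximum.
Variables (R : realType) (N : nat) (Phi Phip : {fset 'rV[R]_N}).
Hypothesis rs : root_system Phi.
Hypothesis ps : positive_subsystem Phi Phip.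
Implicit Types (x y z a b : 'rV[R]_N) (g h : 'M[R]_N) (D : {fset 'rV[R]_N}).
Implicit Types (s : seq 'rV[R]_N).

Lemma positive_sub a : a \in Phip -> a \in Phi.
Proof. by case: ps => v _ /(_ a) ->; case/andP. Qed.

Lemma positive_neq0 a : a \in Phip -> a != 0.
Proof. by move=> /positive_sub; exact: root_neq0. Qed.

Lemma positive_opp a : a \in Phi -> (- a \in Phip) = (a \notin Phip).
Proof.
case: ps => v v0 pv aPhi; rewrite !pv aPhi root_opp//= dotNl oppr_gt0.
by have := v0 a aPhi; case: ltgtP.
Qed.

Definition in_cone D b : Prop := exists2 c : 'rV[R]_N -> R,
  (forall a, 0 <= c a) & b = \sum_(a <- D) c a *: a.

(** This plays the role of a system of simple roots, with minimality phrased through cones instead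
    of linear independence. *)
Definition cone_basis D : Prop :=
  [/\ {subset D <= Phip}, (forall b, b \in Phip -> in_cone D b) &
      forall a, a \in D -> ~ in_cone (D `\ a)%fset a].

Lemma in_coneD D b b' : in_cone D b -> in_cone D b' -> in_cone D (b + b').
Proof.
move=> [c c0 ->] [c' c0' ->]; exists (fun a => c a + c' a).
  by move=> a; rewrite addr_ge0.
by rewrite -big_split; apply: eq_bigr => a _; rewrite scalerDl.
Qed.

Lemma in_coneZ D (e : R) b : 0 <= e -> in_cone D b -> in_cone D (e *: b).
Proof.
move=> e0 [c c0 ->]; exists (fun a => e * c a).
  by move=> a; rewrite mulr_ge0.
by rewrite scaler_sumr; apply: eq_bigr => a _; rewrite scalerA.
Qed.

Lemma in_cone_sum D (I : Type) (r : seq I) (f : I -> 'rV[R]_N) :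
  (forall i, in_cone D (f i)) -> in_cone D (\sum_(i <- r) f i).
Proof.
move=> Df; elim: r => [|i r ih].
  rewrite big_nil; exists (fun=> 0) => //.
  by rewrite big1// => a _; rewrite scale0r.
by rewrite big_cons; exact: in_coneD.
Qed.

Lemma in_cone_mem D a : a \in D -> in_cone D a.
Proof.
move=> aD; exists (fun b => (b == a)%:R); first by move=> b; rewrite ler0n.
rewrite (big_fsetD1 a)//= eqxx scale1r big_seq big1 ?addr0// => b.
by rewrite !inE => /andP[/negbTE ->]; rewrite scale0r.
Qed.

(** A generating subset of least cardinality works: a member in the cone of the others could be
    expanded in them and dropped. *)
Lemma ex_cone_basis : exists D, cone_basis D.
Proof.
pose Q n := `[< exists D, [/\ #|` D| = n, {subset D <= Phip} &
  forall b, b \in Phip -> in_cone D b] >].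
have exQ : exists n, Q n.
  exists #|` Phip|; apply/asboolP; exists Phip; split => // b.
  exact: in_cone_mem.
have [n /asboolP[D [Dn sD cD]] minn] := ex_minnP exQ.
exists D; split => // a aD caD.
have : Q #|` (D `\ a)%fset|.
  apply/asboolP; exists (D `\ a)%fset; split => //.
    by move=> b; rewrite !inE => /andP[_]; exact: sD.
  move=> b /cD[c c0 ->]; rewrite (big_fsetD1 a)//=.
  apply: in_coneD; first exact: in_coneZ.
  rewrite big_seq big_mkcond; apply: in_cone_sum => b'.
  case: ifPn => [bD|_]; first by apply: in_coneZ => //; exact: in_cone_mem.
  by rewrite -[0](scale0r a); exact: in_coneZ.
move=> /minn; rewrite -Dn (cardfsD1 a D) aD add1n.
by rewrite ltnn.
Qed.

Section basis.
Variable D : {fset 'rV[R]_N}.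
Hypothesis cb : cone_basis D.

Let D_sub a : a \in D -> a \in Phip. Proof. by case: cb => h _ _; exact: h. Qed.

(** If [b] is sent to a negative root, then [b] and the opposite of its image both lie in the cone
    and their sum is a multiple of [a]; minimality of [D] forces [b] itself to be a multiple of [a].
    Since the root system need not be reduced, this case is recorded as equality of the
    reflections. *)
Lemma simple_reflection a b : a \in D -> b \in Phip ->
  b *m reflection a \in Phip \/ reflection b = reflection a.
Proof.
move=> aD bP; have aP := D_sub aD.
have [|nbP] := boolP (b *m reflection a \in Phip); [by left|right].
have bPhi : b *m reflection a \in Phi by rewrite root_reflection ?positive_sub.
move: nbP; rewrite -positive_opp// => nbP.
case: cb => _ cD minD.
have [c c0 bE] := cD _ bP; have [c' c0' bE'] := cD _ nbP.
(* [e] is the coefficient in [b - b sigma_a = e a]; [f] is what is left of it after the [a]-terms of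
   the two expansions are subtracted. *)
pose e := 2 / dot a a * dot b a.
pose f := e - (c a + c' a).
have fE : f *: a = \sum_(d <- (D `\ a)%fset) (c d + c' d) *: d.
  have sE : \sum_(d <- D) (c d + c' d) *: d = e *: a.
    transitivity (b + - (b *m reflection a)).
      by rewrite {1}bE bE' -big_split; apply: eq_bigr => d _; rewrite scalerDl.
    by rewrite mul_reflection -/e opprB addrCA subrr addr0.
  rewrite /f scalerBl -sE (big_fsetD1 a)//= addrAC subrr add0r.
  by apply: eq_big_seq.
(* Dividing by a positive [f] would express [a] through the rest of [D]. *)
have f0 : f <= 0.
  rewrite leNgt; apply/negP => f0; apply: (minD a aD).
  exists (fun d => f^-1 * (c d + c' d)).
    by move=> d; rewrite mulr_ge0 ?addr_ge0// invr_ge0 ltW.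
  rewrite -[LHS]scale1r -(mulVf (lt0r_neq0 f0)) -scalerA fE scaler_sumr.
  by apply: eq_bigr => d _; rewrite scalerA.
case: ps => v v0 pv.
have av : 0 < dot a v by move: aP; rewrite pv => /andP[].
(* Pairing with [v], which is positive on [D], makes one side of [fE] non-positive and the other a
   sum of non-negative terms. *)
have /eqP : \sum_(d <- (D `\ a)%fset) (c d + c' d) * dot d v = 0.
  apply/eqP; rewrite eq_le; apply/andP; split.
    apply: (@le_trans _ _ (f * dot a v)); last by rewrite mulr_le0_ge0// ltW.
    by rewrite -dotZl fE dot_suml; apply: ler_sum => d _; rewrite dotZl.
  rewrite big_seq; apply: sumr_ge0 => d; rewrite !inE => /andP[_ /D_sub].
  by rewrite pv => /andP[_ /ltW dv]; rewrite mulr_ge0 ?addr_ge0.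
rewrite big_seq psumr_eq0; last first.
  move=> d; rewrite !inE => /andP[_ /D_sub].
  by rewrite pv => /andP[_ /ltW dv]; rewrite mulr_ge0 ?addr_ge0.
move=> /allP h.
have ce d : d \in (D `\ a)%fset -> c d = 0.
  move=> dD; have := h d dD; rewrite dD/=.
  move: (dD); rewrite !inE => /andP[_ /D_sub]; rewrite pv => /andP[_ dv].
  rewrite mulf_eq0 (gt_eqF dv) orbF paddr_eq0// => /andP[/eqP //].
have bca : b = c a *: a.
  rewrite {1}bE (big_fsetD1 a)//= big_seq big1 ?addr0// => d dD.
  by rewrite ce// scale0r.
rewrite bca reflectionZ//; apply/eqP => ca0.
by have := positive_neq0 bP; rewrite bca ca0 scale0r eqxx.
Qed.

Definition word s : 'M[R]_N := foldr (fun a g => reflection a *m g) 1%:M s.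

Lemma word_cat s s' : word (s ++ s') = word s *m word s'.
Proof. by elim: s => [|a s ih]/=; rewrite ?mul1mx// ih mulmxA. Qed.

Lemma word_rcons s a : word (rcons s a) = word s *m reflection a.
Proof. by rewrite -cats1 word_cat /= mulmx1. Qed.

Lemma word_rev s : word (rev s) = (word s)^T.
Proof.
elim: s => [|a s ih]/=; first by rewrite trmx1.
by rewrite rev_cons word_rcons ih trmx_mul tr_reflection.
Qed.

Lemma word_weyl_group s : {subset s <= D} -> weyl_group Phi (word s).
Proof.
elim: s => [_|a s ih sD]/=; first exact: weyl_group1.
apply: weyl_groupM; last by apply: ih => b bs; rewrite sD// inE bs orbT.
by apply: weyl_group_reflection; rewrite positive_sub// D_sub// sD// mem_head.
Qed.

Definition word_group : set 'M[R]_N :=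
  [set g | exists2 s, {subset s <= D} & g = word s].

Lemma word_groupM g h : word_group g -> word_group h -> word_group (g *m h).
Proof.
move=> [s sD ->] [s' s'D ->]; exists (s ++ s'); last by rewrite word_cat.
by move=> a; rewrite mem_cat => /orP[/sD|/s'D].
Qed.

Lemma word_group_tr g : word_group g -> word_group g^T.
Proof.
move=> [s sD ->]; exists (rev s); last by rewrite word_rev.
by move=> a; rewrite mem_rev; exact: sD.
Qed.

Lemma word_group_simple a : a \in D -> word_group (reflection a).
Proof.
move=> aD; exists [:: a]; last by rewrite /= mulmx1.
by move=> b; rewrite inE => /eqP ->.
Qed.

(* Induction on the height <b, v>: reflecting in a simple root with positive
   pairing lowers it. *)
Lemma word_group_reflection b : b \in Phip -> word_group (reflection b).
Proof.
case: ps => v v0 pv.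
(* Heights are real numbers, so the induction runs on the number of positive roots of smaller
   height. *)
pose rk b := #|` [fset d in Phip | dot d v < dot b v]%fset|.
have [n] := ubnP (rk b); elim: n b => // n ih b rkb bP.
(* [b] lies in the cone of [D], so non-positive pairings with all of [D] would give
   [dot b b <= 0]. *)
have [d dD db] : exists2 d, d \in D & 0 < dot b d.
  apply: contrapT => nd; case: cb => _ /(_ b bP)[c c0 bE] _.
  have : 0 < dot b b by rewrite dot_gt0 positive_neq0.
  rewrite {1}bE dot_suml ltNge => /negP; apply.
  rewrite big_seq; apply: sumr_le0 => d dD; rewrite dotZl mulr_ge0_le0//.
  by rewrite leNgt; apply/negP => bd; apply: nd; exists d; rewrite // dotC.
have dP := D_sub dD.
have [bdP|->] := simple_reflection dD bP; last exact: word_group_simple.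
have lt : dot (b *m reflection d) v < dot b v.
  rewrite mul_reflection dotBl dotZl ltrBlDr ltrDl mulr_gt0//.
    by rewrite mulr_gt0// divr_gt0// dot_gt0 positive_neq0.
  by move: dP; rewrite pv => /andP[].
have : word_group (reflection (b *m reflection d)).
  apply: ih => //; rewrite -ltnS (leq_trans _ rkb)// ltnS.
  apply: fproper_ltn_card; rewrite fproperE; apply/andP; split.
    apply/fsubsetP => e; rewrite !inE => /andP[-> /=].
    by move=> /lt_trans; apply.
  apply/negP => /fsubsetP /(_ (b *m reflection d)).
  by rewrite !inE bdP/= lt ltxx => /(_ isT).
move=> /(word_groupM (word_group_simple dD)) /word_groupM.
move=> /(_ _ (word_group_simple dD)); congr word_group.
have dd := reflectionK (positive_neq0 dP).
rewrite reflection_conj ?tr_reflection// !mulmxA dd mul1mx.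
by rewrite -mulmxA dd mulmx1.
Qed.

Lemma weyl_group_word : weyl_group Phi `<=` word_group.
Proof.
apply: weyl_group_ind.
  split; [by exists [::]|exact: word_groupM|move=> g gw].
  suff -> : invmx g = g^T by exact: word_group_tr.
  have Wg : weyl_group Phi g by case: gw => s sD ->; exact: word_weyl_group.
  rewrite -[LHS]mulmx1 -(weyl_group_orthogonal rs Wg) mulmxA mulVmx ?mul1mx//.
  exact: weyl_group_unit Wg.
move=> a aPhi; have [aP|] := boolP (a \in Phip); first exact: word_group_reflection.
by rewrite -positive_opp// -reflectionN; exact: word_group_reflection.
Qed.

Lemma word_deletion s d : {subset s <= D} -> d \in D ->
  d *m word (rev s) \notin Phip ->
  exists s', [/\ {subset s' <= D}, (size s' < (size s).+1)%N &
                 word s' = word s *m reflection d].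
Proof.
elim: s => [_ dD|a s ih sD dD]; first by rewrite /= mulmx1 D_sub.
rewrite rev_cons word_rcons mulmxA => nP.
have aD : a \in D by rewrite sD// mem_head.
have sD' : {subset s <= D} by move=> b bs; rewrite sD// inE bs orbT.
have [gP|ngP] := boolP (d *m word (rev s) \in Phip); last first.
  have [s' [s'D s's ws']] := ih sD' dD ngP.
  exists (a :: s'); split => //=; last by rewrite ws' mulmxA.
  by move=> b; rewrite inE => /orP[/eqP ->//|/s'D].
have [hP|E] := simple_reflection aD gP; first by rewrite hP in nP.
exists s; split => //=.
have Ws := word_weyl_group sD'.
have wK := weyl_group_trK rs Ws; have wK' := weyl_group_orthogonal rs Ws.
rewrite -E word_rev reflection_conj trmxK// -!mulmxA.
rewrite (mulmxA (word s)^T) wK mul1mx reflectionK ?mulmx1//.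
by rewrite positive_neq0// D_sub.
Qed.

End basis.

(** Induction on the length of a word for [g] with last letter [d]. If the reversed prefix carries
    [d] to a positive root, the last reflection subtracts a non-negative multiple of [d], which
    pairs non-negatively with [l]; otherwise the deletion condition gives a shorter word. *)
Lemma chamber_dot_max y l g : weyl_chamber Phip y -> weyl_chamber Phip l ->
  weyl_group Phi g -> dot (y *m g) l <= dot y l.
Proof.
move=> Cy Cl; have [D cb] := ex_cone_basis.
move=> /(weyl_group_word cb)[s sD ->{g}].
have [n] := ubnP (size s); elim: n s sD => // n ih s.
case/lastP: s => [|s d] sD; first by rewrite /= mulmx1.
rewrite size_rcons ltnS => sn.
have dD : d \in D by rewrite sD// mem_rcons mem_head.
have dP : d \in Phip by case: cb => h _ _; exact: h.
have sD' : {subset s <= D} by move=> b bs; rewrite sD// mem_rcons inE bs orbT.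
have [gP|ngP] := boolP (d *m word (rev s) \in Phip).
  rewrite word_rcons mulmxA mul_reflection dotBl dotZl.
  apply: (@le_trans _ _ (dot (y *m word s) l)); last exact: ih.
  rewrite gerBl mulr_ge0//; last by rewrite dotC Cl.
  rewrite mulr_ge0 ?divr_ge0 ?dot_ge0//.
  by rewrite dot_mulmx -word_rev Cy.
have [s' [s'D s's]] := word_deletion cb sD' dD ngP.
by rewrite -word_rcons => <-; apply: ih => //; rewrite (leq_trans s's).
Qed.

End chamber_maximum.

(** * The Dunkl kernel on real vectors *)

Section maximum_principle.
Variable R : realType.

(** Only earlier times are compared, since the maximum over [0, 1] may sit at the right endpoint;
    the left difference quotients there are non-negative. *)
Lemma is_derive_left_max (f : R -> R) (c df : R) : 0 < c ->
  is_derive c 1 f df -> (forall s, 0 < s <= c -> f s <= f c) -> 0 <= df.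
Proof.
move=> c0 [fc <-] cmax; rewrite ['D_1 f c]cvg_at_leftE; last exact: fc.
apply: limr_ge.
  rewrite -(cvg_at_leftE (fun h => h^-1 *: ((f \o shift c) _ - f c))) //.
  apply: cvg_trans fc; apply: cvg_app.
  move=> A [e egt0 Ae]; exists e => // x xe xgt0; apply: Ae => //.
  exact/ltr0_neq0.
near=> h; apply: mulr_le0.
  by rewrite invr_le0; apply: ltW; near: h; exists 1 => /=.
rewrite subr_le0 [_%:A]mulr1; apply: cmax; near: h.
exists c => //= h; rewrite /= distrC subr0 => /ltr_normlP[h1 _] h0.
by rewrite /shift/=; apply/andP; split; lra.
Unshelve. all: by end_near. Qed.

(** A positive value would make the maximum over all indices and times positive, hence attained at a
    time [s > 0] with non-negative derivative. The hypothesis on [f'] forbids this; it is asked only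
    where [i] dominates all indices at the same time. *)
Lemma maximum_principle (I : finType) (f f' : I -> R -> R) :
  (forall i, continuous (f i)) ->
  (forall i (s : R), 0 < s -> is_derive s 1 (f i) (f' i s)) ->
  (forall i, f i 0 <= 0) ->
  (forall i (s : R), 0 < s <= 1 -> 0 < f i s -> (forall j, f j s <= f i s) ->
    f' i s < 0) ->
  forall i s, 0 <= s <= 1 -> f i s <= 0.
Proof.
move=> cf df f0 fmax i s s01; rewrite leNgt; apply/negP => fi1.
have maxf j : {c | c \in `[0, 1] & forall t, t \in `[0, 1] -> f j t <= f j c}.
  apply: cid2; apply: EVT_max => //.
  exact: continuous_subspaceT.
pose c j := s2val (maxf j).
have cP j : c j \in `[0, 1] by exact: (s2valP (maxf j)).
have cmax j t : t \in `[0, 1] -> f j t <= f j (c j) by exact: (s2valP' (maxf j)).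
pose j := [arg max_(j > i) f j (c j)]%O.
have jmax j' : f j' (c j') <= f j (c j).
  by rewrite /j; case: arg_maxP => // k _; apply.
have fj : 0 < f j (c j).
  by rewrite (lt_le_trans fi1)// (le_trans _ (jmax i))// cmax.
have := cP j; rewrite in_itv/= => /andP[cj0 cj1].
have {}cj0 : 0 < c j.
  rewrite lt_neqAle cj0 andbT; apply: contraTneq fj => <-.
  by rewrite -leNgt f0.
have : f' j (c j) < 0.
  apply: fmax => //; first by rewrite cj0.
  by move=> j'; rewrite (le_trans (cmax _ _ _)).
rewrite ltNge => /negP; apply.
apply: (is_derive_left_max cj0 (df _ _ cj0)) => r /andP[r0 rc].
by rewrite cmax// in_itv/= (ltW r0) (le_trans rc).
Qed.

End maximum_principle.

(** * Finite singular systems along rays: positivity, growth, stability *)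

Section ray_systems.
Variables (R : realType) (I A : finType) (k : A -> R) (tau : A -> I -> I).
Hypothesis k_ge0 : forall a, 0 <= k a.
Implicit Types (D : I -> R) (u : I -> R -> R).

Definition ray_field D u i (s : R) : R :=
  D i * u i s - s^-1 * \sum_a k a * (u i s - u (tau a i) s).

(** The field is singular at [s = 0], so the equation is imposed for [s > 0] and tied to the initial
    value by continuity. For the kernel, [I] is the Weyl group, [A] the set of positive roots, and
    [tau a g = g sigma_a]. *)
Definition ray_system D u : Prop :=
  [/\ forall i, continuous (u i),
      forall i (s : R), 0 < s -> is_derive s 1 (u i) (ray_field D u i s) &
      forall i, u i 0 = 1].

Let ray_sum_ge0 (h : I -> R) i : (forall j, h j <= h i) ->
  0 <= \sum_a k a * (h i - h (tau a i)).
Proof. by move=> hi; apply: sumr_ge0 => a _; rewrite mulr_ge0// subr_ge0. Qed.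

Lemma is_derive_expRM (K s : R) :
  is_derive s 1 (fun s => expR (K * s)) (K * expR (K * s)).
Proof.
have h : is_derive s 1 (fun s => K * s) K.
  by apply: is_derive_eq; rewrite [LHS]mulr1.
rewrite mulrC; exact: (is_derive1_comp (is_derive_expR _) h).
Qed.

Let is_derive_scaled (K : R) u i (s du : R) : is_derive s 1 (u i) du ->
  is_derive s 1 (fun s => expR (- K * s) * u i s)
    (expR (- K * s) * (du - K * u i s)).
Proof.
move=> h; have he := is_derive_expRM (- K) s.
apply: (is_derive_eq (is_deriveM he h)).
by rewrite /GRing.scale/=; ring.
Qed.

Let continuous_scaled (K : R) u i : continuous (u i) ->
  continuous (fun s => expR (- K * s) * u i s).
Proof.
move=> cu s; apply: cvgM; last exact: cu.
apply: (@continuous_comp _ _ _ (fun s => - K * s) expR); last exact: continuous_expR.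
by apply: cvgM; [exact: cvg_cst|exact: cvg_id].
Qed.

(** The factor [expR (- K * s)] with [K] above all [D i] makes the linear term strictly dissipative.
    Where the scaled [u] is most negative the difference sum also pushes upwards, so the maximum
    principle applies to the negated scaled functions. *)
Lemma ray_system_ge0 D u i s : ray_system D u -> 0 <= s <= 1 -> 0 <= u i s.
Proof.
move=> [cu du u0] s01.
pose K := 1 + \sum_i `|D i|.
have KD j : D j < K.
  rewrite /K (bigD1 j)//= ltr_pwDl// (le_trans (ler_norm _))// lerDl.
  by rewrite sumr_ge0.
pose f j s := - (expR (- K * s) * u j s).
suff : f i s <= 0 by rewrite oppr_le0 pmulr_rge0// expR_gt0.
pose f' j s := - (expR (- K * s) * (ray_field D u j s - K * u j s)).
move: i s s01; apply: (@maximum_principle _ _ f f').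
- by move=> j s; apply: cvgN; apply: (continuous_scaled (cu j)).
- move=> j s s0; apply: is_deriveN; apply: is_derive_scaled; exact: du.
- by move=> j; rewrite /f u0 mulr0 expR0 mulr1 oppr_le0.
- move=> j s /andP[s0 s1]; rewrite oppr_gt0 pmulr_rlt0 ?expR_gt0// => us fs.
  rewrite oppr_lt0 pmulr_rgt0 ?expR_gt0// /ray_field.
  have : 0 <= s^-1 * - \sum_a k a * (u j s - u (tau a j) s).
    apply: mulr_ge0; first by rewrite invr_ge0 ltW.
    rewrite -sumrN; apply: sumr_ge0 => a _; rewrite -mulrN opprB mulr_ge0// subr_ge0.
    have := fs (tau a j).
    by rewrite lerN2 ler_pM2l// expR_gt0.
  have KDj : D j - K < 0 by rewrite subr_lt0.
  have : 0 < (D j - K) * u j s by rewrite nmulr_rgt0.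
  lra.
Qed.

Lemma ray_system_le_expR D u (K : R) i s : ray_system D u -> (forall j, D j < K) ->
  0 <= s <= 1 -> u i s <= expR (K * s).
Proof.
move=> [cu du u0] KD s01.
pose f j s := expR (- K * s) * u j s - 1.
suff : f i s <= 0 by rewrite subr_le0 mulNr expRN ler_pdivrMl ?expR_gt0// mulr1.
pose f' j s := expR (- K * s) * (ray_field D u j s - K * u j s) - 0.
move: i s s01; apply: (@maximum_principle _ _ f f').
- move=> j s; apply: cvgB; last exact: cvg_cst.
  by apply: (continuous_scaled (cu j)).
- move=> j s s0; apply: is_deriveB; apply: is_derive_scaled; exact: du.
- by move=> j; rewrite /f u0 mulr0 expR0 mulr1 subrr.
- move=> j s /andP[s0 s1]; rewrite subr_gt0 => fs fm.
  have us : 0 < u j s.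
    by rewrite -(pmulr_rgt0 _ (expR_gt0 (- K * s))) (lt_trans _ fs).
  rewrite /f' subr0 pmulr_rlt0 ?expR_gt0// /ray_field.
  have : 0 <= s^-1 * \sum_a k a * (u j s - u (tau a j) s).
    apply: mulr_ge0; first by rewrite invr_ge0 ltW.
    apply: (ray_sum_ge0 (h := fun j => u j s)) => j'.
    by have := fm j'; rewrite lerD2r ler_pM2l// expR_gt0.
  have KDj : D j - K < 0 by rewrite subr_lt0.
  have : (D j - K) * u j s < 0 by rewrite nmulr_rlt0.
  lra.
Qed.

(** The difference [w] solves the system for [D] with source [(D - D') u']. After scaling,
    positivity and [ray_system_le_expR] bound the source by [d], which the subtracted [d * s]
    absorbs. *)
Let ray_system_sub D D' u u' (K d : R) i : ray_system D u -> ray_system D' u' ->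
  (forall j, D j < K) -> (forall j, D' j < K) -> (forall j, `|D j - D' j| <= d) ->
  u i 1 - u' i 1 <= d * expR K.
Proof.
move=> su su' KD KD' dd.
have [cu du u0] := su; have [cu' du' u'0] := su'.
have d0 : 0 <= d := le_trans (normr_ge0 _) (dd i).
pose w j s := u j s - u' j s.
pose f j s := expR (- K * s) * w j s - d * s.
suff : f i 1 <= 0.
  by rewrite /f !mulr1 subr_le0 mulrC expRN ler_pdivrMr// expR_gt0.
pose f' j s := expR (- K * s) *
  ((ray_field D u j s - ray_field D' u' j s) - K * w j s) - d.
apply: (@maximum_principle _ _ f f'); last by rewrite ler01 lexx.
- move=> j s; apply: cvgB; last first.
    by apply: cvgM; [exact: cvg_cst|exact: cvg_id].
  apply: (@continuous_scaled _ (fun j s => u j s - u' j s)) => t.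
  by apply: continuousB; [exact: cu|exact: cu'].
- move=> j s s0; apply: is_deriveB.
    apply: (@is_derive_scaled _ (fun j s => u j s - u' j s)).
    by apply: is_deriveB; [exact: du|exact: du'].
  by apply: is_derive_eq; rewrite [LHS]mulr1.
- by move=> j; rewrite /f /w u0 u'0 subrr mulr0 sub0r mulr0 oppr0.
- move=> j s s01 fjs fj; have /andP[s0 s1] := s01.
  have ws : 0 < w j s.
    rewrite -(pmulr_rgt0 _ (expR_gt0 (- K * s))); move: fjs; rewrite subr_gt0.
    by apply: le_lt_trans; rewrite mulr_ge0// ltW.
  have S0 : 0 <= s^-1 * \sum_a k a * (w j s - w (tau a j) s).
    apply: mulr_ge0; first by rewrite invr_ge0 ltW.
    apply: (ray_sum_ge0 (h := fun j => w j s)) => j'.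
    by have := fj j'; rewrite lerD2r ler_pM2l// expR_gt0.
  have KDj : D j - K < 0 by rewrite subr_lt0.
  have Dw : (D j - K) * w j s < 0 by rewrite nmulr_rlt0.
  have s01' : 0 <= s <= 1 by rewrite ltW.
  have u's : expR (- K * s) * u' j s <= 1.
    by rewrite mulNr expRN ler_pdivrMl ?expR_gt0// mulr1 (ray_system_le_expR _ su').
  have u's0 : 0 <= expR (- K * s) * u' j s.
    by rewrite mulr_ge0 ?expR_ge0// (ray_system_ge0 _ su').
  have DD : (D j - D' j) * (expR (- K * s) * u' j s) <= d.
    rewrite (le_trans (ler_norm _))// normrM (ger0_norm u's0).
    by rewrite -[leRHS]mulr1 ler_pM.
  rewrite /f' subr_lt0 (lt_le_trans _ DD)// mulrCA ltr_pM2l ?expR_gt0//.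
  rewrite /ray_field.
  have -> : \sum_a k a * (u j s - u (tau a j) s) =
      \sum_a k a * (w j s - w (tau a j) s) +
      \sum_a k a * (u' j s - u' (tau a j) s).
    by rewrite -big_split; apply: eq_bigr => a _; rewrite /w/=; ring.
  move: S0 Dw; rewrite /w mulrDr; lra.
Qed.

Lemma ray_system_dist D D' u u' (K d : R) i :
  ray_system D u -> ray_system D' u' ->
  (forall j, D j < K) -> (forall j, D' j < K) -> (forall j, `|D j - D' j| <= d) ->
  `|u i 1 - u' i 1| <= d * expR K.
Proof.
move=> su su' KD KD' dd; rewrite ler_norml lerNl opprB.
rewrite (ray_system_sub _ su su')// andbT (ray_system_sub _ su' su)// => j.
by rewrite distrC.
Qed.

End ray_systems.

(** * Differentiation along real rays inside complex space *)

Section real_restriction.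
Variables (R : realType) (N : nat).
Implicit Types (x y w : 'rV[R]_N).

Lemma cvg_real_complex0 : (fun h : R => h%:C%C) @ 0^' --> (0 : R[i])^'.
Proof.
move=> U [e /= e0 eU]; have [er er0 eE] : exists2 er : R, 0 < er & e = er%:C%C.
  move: e0 {eU}; case: e => a b; rewrite ltcE/= => /andP[/eqP -> a0].
  by exists a.
exists er => //= h; rewrite /ball/= sub0r normrN => hr h0.
apply: eU; last by apply: contra_neq h0 => /= -[].
by rewrite /ball_/= sub0r normrN eE normc_def/= expr0n/= addr0 sqrtr_sqr ltcR.
Qed.

Lemma continuous_Re : continuous (@complex.Re R : R[i] -> R).
Proof.
move=> z U [e /= e0 eU]; exists (e%:C%C); first by rewrite /= ltcR.
move=> z' zz'; apply: eU; move: zz'.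
rewrite /ball_/= => zz'; rewrite -ltcR -raddfB.
exact: le_lt_trans (normc_ge_Re _) zz'.
Qed.

Lemma cplxD x y : cplx (x + y) = cplx x + cplx y.
Proof. by rewrite /cplx map_mxD. Qed.

Lemma cplxZ (c : R) x : cplx (c *: x) = c%:C%C *: cplx x.
Proof. by rewrite /cplx map_mxZ. Qed.

Lemma cplxM m n p (A : 'M[R]_(m, n)) (B : 'M[R]_(n, p)) :
  cplx (A *m B) = cplx A *m cplx B.
Proof. by rewrite /cplx map_mxM. Qed.

Lemma cplx0 : cplx (0 : 'rV[R]_N) = 0.
Proof. by rewrite /cplx map_mx0. Qed.

Lemma dot_cplx x y : dot (cplx x) (cplx y) = (dot x y)%:C%C.
Proof.
by rewrite /dot rmorph_sum; apply: eq_bigr => i _; rewrite !mxE rmorphM.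
Qed.

(** Real increments approach 0 inside the punctured complex plane and [Re] is continuous, so the
    complex directional derivative restricts to a real one. *)
Lemma is_derive_Re (f : 'rV[R[i]]_N -> R[i]) x (s : R) :
  differentiable f (cplx (s *: x)) ->
  is_derive s 1 (fun t : R => complex.Re (f (cplx (t *: x))))
    (complex.Re ('D_(cplx x) f (cplx (s *: x)))).
Proof.
move=> /(@diff_derivable _ _ _ _ _ (cplx x)) df.
have h : h^-1 *: (((fun t : R => complex.Re (f (cplx (t *: x)))) \o shift s) (h *: 1)
    - complex.Re (f (cplx (s *: x)))) @[h --> (0 : R)^'] -->
    complex.Re ('D_(cplx x) f (cplx (s *: x))).
  have H := cvg_comp _ _ cvg_real_complex0 df.
  have H2 := cvg_comp _ (@complex.Re R) H (@continuous_Re ('D_(cplx x) f (cplx (s *: x)))).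
  apply: (cvg_trans _ H2); apply: near_eq_cvg; near=> h => /=.
  rewrite scaler1 scalerDl cplxD !cplxZ.
  set a := f _; set b := f _.
  rewrite -raddfB/= -fmorphV; case: (a - b) => p q /=.
  by rewrite mul0r subr0.
by split; [apply/cvg_ex; eexists; exact: h|exact: cvg_lim h].
Unshelve. all: by end_near. Qed.

End real_restriction.

(** * The Dunkl kernel restricted to real vectors *)

Section kernel_on_reals.
Variables (R : realType) (N : nat) (Phi Phip : {fset 'rV[R]_N}).
Variables (k : 'rV[R]_N -> R) (E : 'rV[R[i]]_N -> 'rV[R[i]]_N -> R[i]).
Hypothesis rs : root_system Phi.
Hypothesis ps : positive_subsystem Phi Phip.
Hypothesis mk : multiplicity Phi k.
Hypothesis dk : is_dunkl_kernel Phip k E.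
Implicit Types (x y z w : 'rV[R]_N) (g h : 'M[R]_N).

Local Notation F := (on_reals E).
Local Notation W := (fset_set (weyl_group Phi)).

Lemma mem_weyl_fset g : (g \in W) <-> weyl_group Phi g.
Proof. by rewrite in_fset_set ?in_setE//; case: rs. Qed.

Lemma multiplicity_ge0 a : a \in Phip -> 0 <= k a.
Proof. by move=> /(positive_sub ps)/mk[]. Qed.

Lemma kernel0l w : F 0 w = 1.
Proof. by rewrite /on_reals cplx0; case: (dk (cplx w)) => -[_ _ ->]. Qed.

Lemma kernel_derivable x w (s : R) : derivable (fun t : R => F (t *: x) w) s 1.
Proof.
have [[dE _ _] _] := dk (cplx w).
by have [] := @is_derive_Re _ _ (E ^~ (cplx w)) x s (dE _).
Qed.

(** Base point and direction are both multiples of [x]: the factor [<a, x>] of the Dunkl operator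
    cancels against the denominator [<a, s x>] and leaves [1/s]. *)
Lemma kernel_ray_derive x w (s : R) : s != 0 ->
  is_derive s 1 (fun t : R => F (t *: x) w)
    (dot x w * F (s *: x) w - s^-1 *
     \sum_(a <- Phip) k a * (F (s *: x) w - F (s *: (x *m reflection a)) w)).
Proof.
move=> s0; have [[dE eqE _] _] := dk (cplx w).
apply: (is_derive_eq (@is_derive_Re _ _ (E ^~ (cplx w)) x s (dE _))).
have := eqE (cplx x) (cplx (s *: x)); rewrite /dunkl_operator.
move=> /(canRL (addrK _)) ->; rewrite raddfB/= dot_cplx; congr (_ - _).
  by rewrite /on_reals; case: (E _ _) => p q /=; rewrite mul0r subr0.
rewrite raddf_sum mulr_sumr; apply: eq_big_seq => a aP.
(* On the hyperplane of [a] the limit inside [dunkl_quotient] is multiplied by [<a, x> = 0], and [x]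
   is its own reflection. *)
rewrite dot_cplx; have [ax|ax] := eqVneq (dot a x) 0.
  have -> : x *m reflection a = x by rewrite mul_reflection dotC ax mulr0 scale0r subr0.
  by rewrite ax subrr !mulr0 mul0r.
rewrite /dunkl_quotient dot_cplx dotZr.
have sax : s * dot a x != 0 by rewrite mulf_neq0.
rewrite ifT; last by rewrite (inj_eq (@complexI R)).
rewrite -cplxM -scalemxAl /on_reals.
set A := E _ _; set B := E _ _.
rewrite -raddfB/= mulrCA mulrA -rmorphM mulrCA -fmorphV -mulrA.
rewrite [_%:C%C * _]mulrC.
rewrite -rmorphM (_ : _^-1 * _ = k a * s^-1); last by field; apply/andP.
by case: (A - B) => p q /=; rewrite mulr0 subr0 mulrC mulrA.
Qed.

Let weyl_mul (a : Phip) (g : W) : fsval g *m reflection (fsval a) \in W.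
Proof.
apply/mem_weyl_fset; apply: weyl_groupM; first exact/mem_weyl_fset/fsvalP.
exact: weyl_group_reflection (positive_sub ps (fsvalP a)).
Qed.

Let tau (a : Phip) (g : W) : W := [` weyl_mul a g]%fset.
Let kA (a : Phip) : R := k (fsval a).
Let weyl_of (g : W) : weyl_group Phi (fsval g).
Proof. by apply/mem_weyl_fset; exact: fsvalP. Qed.
Let one_W : (1%:M : 'M[R]_N) \in W.
Proof. by apply/mem_weyl_fset; exact: weyl_group1. Qed.
Let id_W : W := [` one_W]%fset.

Let kA_ge0 a : 0 <= kA a.
Proof. by rewrite multiplicity_ge0 ?fsvalP. Qed.

(** The scalar [c] sits in the second argument so that uniqueness can compare [F (c *: x) w] with
    [F x (c *: w)]. *)
Let kernel_ray_system (c : R) x w :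
  ray_system kA tau (fun g : W => c * dot (x *m fsval g) w)
    (fun (g : W) t => F (t *: (x *m fsval g)) (c *: w)).
Proof.
split => [g s|g s s0|g]; last by rewrite scale0r kernel0l.
  apply: differentiable_continuous; apply/derivable1_diffP.
  exact: kernel_derivable.
apply: (is_derive_eq (kernel_ray_derive _ _ _)); first exact: lt0r_neq0.
rewrite /ray_field dotZr; congr (_ - _ * _).
rewrite big_seq_fsetE; apply: eq_bigr => a _.
by rewrite mulmxA.
Qed.

Lemma kernel_ge0 x w : 0 <= F x w.
Proof.
have := ray_system_ge0 kA_ge0 id_W (kernel_ray_system 1 x w).
by move=> /(_ 1); rewrite ler01 lexx mulmx1 !scale1r; exact.
Qed.

Let dot_le (x w : 'rV[R]_N) g : weyl_group Phi g -> `|dot (x *m g) w| <= enorm x * enorm w.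
Proof. by move=> Wg; rewrite -(enorm_weyl_group rs x Wg) normr_dot_le. Qed.

(** Stability of the two ray systems at time 1: since [g] is orthogonal, the rates [<x g, w>] and
    [<x g, w'>] differ by at most [|x| |w - w'|]. *)
Lemma kernel_dist x w w' : `|F x w - F x w'| <=
  enorm x * enorm (w - w') * expR (1 + enorm x * (enorm w + enorm w')).
Proof.
have := @ray_system_dist _ _ _ _ _ kA_ge0 _ _ _ _
  (1 + enorm x * (enorm w + enorm w')) (enorm x * enorm (w - w')) id_W
  (kernel_ray_system 1 x w) (kernel_ray_system 1 x w').
rewrite mulmx1 !scale1r; apply => g.
- rewrite mul1r (le_lt_trans (ler_norm _))// (le_lt_trans (dot_le x w (weyl_of g)))//.
  by rewrite mulrDr addrCA ltrDl ltr_pwDl// mulr_ge0 ?enorm_ge0.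
- rewrite mul1r (le_lt_trans (ler_norm _))// (le_lt_trans (dot_le x w' (weyl_of g)))//.
  by rewrite mulrDr addrA ltrDr ltr_pwDl// mulr_ge0 ?enorm_ge0.
- by rewrite -mulrBr mul1r -dotBr dot_le.
Qed.

(** The stability estimate with [d = 0]. *)
Let ray_system_uniq D u u' : ray_system kA tau D u -> ray_system kA tau D u' ->
  u id_W 1 = u' id_W 1.
Proof.
move=> su su'; apply/eqP; rewrite -subr_eq0 -normr_le0.
pose K := 1 + \sum_i `|D i|.
have KD j : D j < K.
  rewrite /K (bigD1 j)//= ltr_pwDl// (le_trans (ler_norm _))// lerDl.
  by rewrite sumr_ge0.
have := @ray_system_dist _ _ _ _ _ kA_ge0 _ _ _ _ K 0 id_W su su' KD KD.
by rewrite mul0r; apply => j; rewrite subrr normr0.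
Qed.

Lemma kernelZ (c : R) x w : F (c *: x) w = F x (c *: w).
Proof.
have := kernel_ray_system 1 (c *: x) w.
rewrite (_ : (fun g : W => _) = (fun g : W => c * dot (x *m fsval g) w)); last first.
  by apply/funext => g; rewrite mul1r -scalemxAl dotZl.
move=> /ray_system_uniq /(_ (kernel_ray_system c x w)).
by rewrite !mulmx1 !scale1r.
Qed.

Lemma sum_positive_roots (f : 'rV[R]_N -> R) :
  (forall a, a \in Phi -> f (- a) = f a) ->
  \sum_(a <- Phi) f a = (\sum_(a <- Phip) f a) *+ 2.
Proof.
move=> fN.
have sub : (Phip `<=` Phi)%fset by apply/fsubsetP => a; exact: positive_sub.
rewrite (big_fsetID _ (mem Phip))/= mulr2n; congr (_ + _).
  apply: eq_fbigl => a; rewrite !inE; apply: andb_idl.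
  exact: positive_sub.
have -> : [fset a | a in Phi & a \notin Phip]%fset = [fset - a | a in Phip]%fset.
  apply/fsetP => a; rewrite !inE/=; apply/andP/imfsetP => [[aPhi aP]|[b bP ->]].
    by exists (- a); rewrite ?opprK//= (positive_opp rs ps).
  have bPhi := positive_sub ps bP.
  by rewrite (positive_opp rs ps)// bP; split=> //; exact: root_opp.
rewrite big_imfset/=; last by move=> a b _ _; exact: oppr_inj.
by apply: eq_big_seq => a /(positive_sub ps)/fN.
Qed.

(** [h] need not map [Phip] to itself. Doubling turns both sides into sums over all of [Phi], which
    [h] permutes, and evenness of [f] takes care of the signs. *)
Lemma sum_positive_roots_weyl_group (f : 'rV[R]_N -> R) h : weyl_group Phi h ->
  (forall a, a \in Phi -> f (- a) = f a) ->
  \sum_(a <- Phip) f (a *m h) = \sum_(a <- Phip) f a.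
Proof.
move=> Wh fN; apply: (@mulIr _ 2%:R).
  by rewrite unitfE pnatr_eq0.
rewrite /= !mulr_natr -!sum_positive_roots//; last first.
  by move=> a aPhi; rewrite mulNmx fN// (root_weyl_group rs).
have PhiE : Phi = [fset a *m h | a in Phi]%fset.
  apply/fsetP => a; apply/idP/imfsetP => [aPhi|[b bPhi ->]]; last first.
    by rewrite (root_weyl_group rs).
  exists (a *m h^T); last by rewrite -mulmxA (weyl_group_trK rs)// mulmx1.
  by rewrite /= (root_weyl_group rs)//; exact: weyl_group_inv.
rewrite [in RHS]PhiE big_imfset//= => a b _ _ /(congr1 (mulmx^~ h^T)).
by rewrite -!mulmxA (weyl_group_orthogonal rs)// !mulmx1.
Qed.

(** The functions along the rays of [x g h] with parameter [w h] solve the same ray system as those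
    along [x g] with parameter [w]. *)
Lemma kernel_weyl_group h x w : weyl_group Phi h -> F (x *m h) (w *m h) = F x w.
Proof.
move=> Wh.
have su : ray_system kA tau (fun g : W => 1 * dot (x *m fsval g) w)
    (fun (g : W) t => F (t *: (x *m fsval g *m h)) (w *m h)).
  split => [g s|g s s0|g]; last by rewrite scale0r kernel0l.
    apply: differentiable_continuous; apply/derivable1_diffP.
    exact: kernel_derivable.
  apply: (is_derive_eq (kernel_ray_derive _ _ _)); first exact: lt0r_neq0.
  rewrite /ray_field mul1r (dot_weyl_group rs)//; congr (_ - _ * _).
  (* After the sum is shifted from [a] to [a h], the identity [h sigma_(a h) = sigma_a h] moves [h]
     to the end. *)
  set f := fun a : 'rV[R]_N => k a *
    (F (s *: (x *m fsval g *m h)) (w *m h) -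
     F (s *: (x *m fsval g *m h *m reflection a)) (w *m h)).
  rewrite -(@sum_positive_roots_weyl_group f h)//; last first.
    move=> a aPhi; rewrite /f reflectionN; congr (_ * _).
    have [_ kW] := mk aPhi.
    by rewrite -[in RHS](kW _ (weyl_group_reflection aPhi)) mul_reflection_self// (root_neq0 rs).
  rewrite big_seq_fsetE; apply: eq_bigr => a _; rewrite /f /kA /=.
  have aPhi := positive_sub ps (fsvalP a).
  have [_ /(_ h Wh) ->] := mk aPhi.
  rewrite reflection_conj ?(weyl_group_orthogonal rs)//.
  rewrite -!mulmxA (mulmxA h h^T) (weyl_group_orthogonal rs Wh) mul1mx.
  by rewrite !mulmxA.
have := ray_system_uniq su (kernel_ray_system 1 x w).
by rewrite !mulmx1 !scale1r.
Qed.

End kernel_on_reals.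

Lemma continuous_sum (R : realType) (T : topologicalType) (I : Type) (r : seq I)
  (f : I -> T -> R) : (forall i, continuous (f i)) ->
  continuous (fun x => \sum_(i <- r) f i x).
Proof.
move=> cf; elim: r => [|i r ih] x.
  rewrite (_ : (fun y => _) = cst 0); first exact: cst_continuous.
  by apply/funext => y; rewrite big_nil.
rewrite (_ : (fun y => _) = f i \+ (fun y => \sum_(j <- r) f j y)).
  exact: (continuousD (@cf i x) (ih x)).
by apply/funext => y; rewrite big_cons.
Qed.

Section continuity_on_reals.
Variables (R : realType) (N : nat).
Implicit Types (x y w : 'rV[R]_N).

Lemma continuous_cplx : continuous (@cplx R 1 N : 'rV[R]_N -> 'rV[R[i]]_N).
Proof.
move=> x U /nbhs_ballP[e e0 eU].
have [er er0 eE] : exists2 er : R, 0 < er & e = er%:C%C.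
  move: e0 {eU}; case: e => a b /=; rewrite ltcE/= => /andP[/eqP -> a0].
  by exists a.
apply/nbhs_ballP; exists er => //= y [_ xy]; apply: eU.
split; first by rewrite eE ltcR.
move=> i j; have := xy i j; rewrite /ball/= => h.
by rewrite !mxE -rmorphB normc_def/= expr0n/= addr0 sqrtr_sqr eE ltcR.
Qed.

Lemma continuous_on_reals (E : 'rV[R[i]]_N -> 'rV[R[i]]_N -> R[i]) w :
  (forall z, differentiable (E ^~ (cplx w)) z) -> continuous (on_reals E ^~ w).
Proof.
move=> dE x.
have cE : {for cplx x, continuous (E ^~ (cplx w))}.
  exact: differentiable_continuous.
have h := cvg_comp _ _ (@continuous_cplx x) cE.
exact: (cvg_comp _ (@complex.Re R) h (@continuous_Re R _)).
Qed.

End continuity_on_reals.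

(** * The Bessel function on real vectors and its radial growth *)

Section bessel_on_reals.
Variables (R : realType) (N : nat) (Phi Phip : {fset 'rV[R]_N}).
Variables (k : 'rV[R]_N -> R) (E : 'rV[R[i]]_N -> 'rV[R[i]]_N -> R[i]).
Hypothesis rs : root_system Phi.
Hypothesis ps : positive_subsystem Phi Phip.
Hypothesis mk : multiplicity Phi k.
Hypothesis dk : is_dunkl_kernel Phip k E.
Implicit Types (x y z w l : 'rV[R]_N) (g h : 'M[R]_N).

Local Notation F := (on_reals E).
Local Notation J := (on_reals (bessel_function Phi E)).
Local Notation W := (fset_set (weyl_group Phi)).
Local Notation "'#W'" := (#|` W|%:R : R).

Lemma weyl_card_gt0 : 0 < #W.
Proof.
rewrite ltr0n cardfs_gt0; apply/fset0Pn; exists 1%:M.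
by apply/(mem_weyl_fset rs); exact: weyl_group1.
Qed.

Lemma besselE x w : J x w = #W^-1 * \sum_(g <- W) F x (w *m g).
Proof.
rewrite /on_reals /bessel_function.
rewrite (_ : #|` W|%:R = #W%:C%C); last by rewrite rmorph_nat.
rewrite -fmorphV.
rewrite (_ : \sum_(g <- W) E _ _ = \sum_(g <- W) E (cplx x) (cplx (w *m g))); last first.
  by apply: eq_bigr => g _; rewrite cplxM.
rewrite -(raddf_sum (@complex.Re R)).
by case: (\sum_(g <- W) _) => p q /=; rewrite mul0r subr0.
Qed.

Lemma bessel0l w : J 0 w = 1.
Proof.
rewrite besselE (eq_bigr (fun=> 1)) => [|g _]; last by rewrite (kernel0l dk).
by rewrite big_const_seq count_predT iter_addr_0 mulVf// lt0r_neq0// weyl_card_gt0.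
Qed.

Lemma bessel_ge0 x w : 0 <= J x w.
Proof.
rewrite besselE mulr_ge0 ?invr_ge0 ?ler0n// sumr_ge0// => g _.
exact: (kernel_ge0 rs ps mk dk).
Qed.

Lemma besselZ (c : R) x w : J (c *: x) w = J x (c *: w).
Proof.
rewrite !besselE; congr (_ * _); apply: eq_bigr => g _.
by rewrite (kernelZ rs ps mk dk) scalemxAl.
Qed.

Lemma bessel_dist x w w' : `|J x w - J x w'| <=
  enorm x * enorm (w - w') * expR (1 + enorm x * (enorm w + enorm w')).
Proof.
set B := _ * expR _.
rewrite !besselE -mulrBr -sumrB normrM ger0_norm ?invr_ge0 ?ler0n//.
rewrite ler_pdivrMl ?weyl_card_gt0// (le_trans (ler_norm_sum _ _ _))//.
rewrite mulr_natl -(iter_addr_0 #|` W|) -(count_predT W) -big_const_seq.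
rewrite big_seq [leRHS]big_seq; apply: ler_sum => g /(mem_weyl_fset rs) Wg.
rewrite (le_trans (kernel_dist rs ps mk dk _ _ _))//.
by rewrite -mulmxBl !(enorm_weyl_group rs).
Qed.

(** Relabelling the average by [g h] puts [h] on both arguments of [F], where it cancels. *)
Lemma bessel_weyl_group h x w : weyl_group Phi h -> J (x *m h) w = J x w.
Proof.
move=> Wh; rewrite !besselE; congr (_ * _).
have WE : W = [fset g *m h | g in W]%fset.
  apply/fsetP => g; apply/idP/imfsetP => [/(mem_weyl_fset rs) Wg|[g' /(mem_weyl_fset rs) Wg' ->]].
    exists (g *m h^T); last by rewrite -mulmxA (weyl_group_trK rs)// mulmx1.
    apply/(mem_weyl_fset rs); apply: weyl_groupM => //.
    exact: (weyl_group_inv rs).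
  by apply/(mem_weyl_fset rs); exact: weyl_groupM.
rewrite [in LHS]WE big_imfset/=; last first.
  move=> a b _ _ /(congr1 (mulmx^~ h^T)).
  by rewrite -!mulmxA (weyl_group_orthogonal rs)// !mulmx1.
by apply: eq_bigr => g _; rewrite mulmxA (kernel_weyl_group rs ps mk dk).
Qed.

Lemma continuous_bessel l : continuous (J ^~ l).
Proof.
rewrite (_ : J ^~ l = fun x => #W^-1 * \sum_(g <- W) F x (l *m g)); last first.
  by apply/funext => x; rewrite besselE.
have cS : continuous (fun x => \sum_(g <- W) F x (l *m g)).
  apply: (@continuous_sum _ _ _ _ (fun g y => F y (l *m g))) => g.
  by apply: continuous_on_reals; case: (dk (cplx (l *m g))) => -[].
move=> x. exact (cvgM (@cst_continuous _ R #W^-1 x) (cS x)).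
Qed.

(** Summing the ray equations over [g] turns the difference terms into multiples of
    [J (s y) l - J (s y sigma_a) l], which vanish by invariance. *)
Lemma bessel_radial_derive y l (s : R) : 0 < s ->
  is_derive s 1 (fun t : R => J (t *: y) l)
    (#W^-1 * \sum_(g <- W) dot y (l *m g) * F (s *: y) (l *m g)).
Proof.
move=> s0.
rewrite (_ : (fun t : R => _) = fun t => #W^-1 * \sum_(g <- W) F (t *: y) (l *m g)); last first.
  by apply/funext => t; rewrite besselE.
pose G (x : 'rV[R]_N) := \sum_(g <- W) F x (l *m g).
have GE x : G x = #W * J x l.
  by rewrite besselE mulrA divff ?mul1r// lt0r_neq0// weyl_card_gt0.
have : is_derive s 1 (fun t : R => \sum_(g <- W) F (t *: y) (l *m g))
    (\sum_(g <- W) (dot y (l *m g) * F (s *: y) (l *m g) - s^-1 *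
     \sum_(a <- Phip) k a * (F (s *: y) (l *m g) -
       F (s *: (y *m reflection a)) (l *m g)))).
  elim: (enum_fset W) => [|g r ih].
    rewrite big_nil; rewrite (_ : (fun t : R => _) = cst 0); last first.
      by apply/funext => t; rewrite big_nil.
    exact: is_derive_cst.
  rewrite big_cons; rewrite (_ : (fun t : R => _) =
    (fun t => F (t *: y) (l *m g)) + (fun t => \sum_(g <- r) F (t *: y) (l *m g))); last first.
    by apply/funext => t; rewrite big_cons.
  exact: (is_deriveD (kernel_ray_derive dk y (l *m g) (lt0r_neq0 s0)) ih).
rewrite sumrB -mulr_sumr exchange_big/=.
rewrite [X in _ - _ * X](_ : _ = 0); last first.
  rewrite big_seq; apply: big1 => a aP.
  rewrite -mulr_sumr sumrB -/(G _) -/(G _) !GE scalemxAl bessel_weyl_group ?subrr ?mulr0//.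
  exact: weyl_group_reflection (positive_sub ps aP).
rewrite mulr0 subr0 => h.
exact: (@is_deriveZ _ _ _ _ #W^-1 _ _ _ h).
Qed.

(* On the chamber every <y, l g> is at most <y, l>. *)
Lemma bessel_radial_growth y l (s : R) :
  weyl_chamber Phip y -> weyl_chamber Phip l -> 1 <= s ->
  J (s *: y) l <= expR ((s - 1) * dot y l) * J y l.
Proof.
move=> Cy Cl s1.
(* The claim says that [J (t y) l] divided by [expR (t * dot y l)] does not increase from 1 to [s];
   the mean value theorem reduces it to the sign of [df]. *)
pose f (t : R) := expR (- dot y l * t) * J (t *: y) l.
suff : f s <= f 1.
  rewrite /f scale1r mulr1 !mulNr !expRN ler_pdivrMl ?expR_gt0// mulrA -expRN -expRD.
  by rewrite (_ : _ - _ = (s - 1) * dot y l)//; ring.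
pose D (t : R) := #W^-1 * \sum_(g <- W) dot y (l *m g) * F (t *: y) (l *m g).
pose df (t : R) := expR (- dot y l * t) * (D t - dot y l * J (t *: y) l).
have fdf (t : R) : 0 < t -> is_derive t 1 f (df t).
  move=> t0; have he := is_derive_expRM (- dot y l) t.
  apply: (is_derive_eq (is_deriveM he (bessel_radial_derive y l t0))).
  by rewrite /GRing.scale/= /df /D; ring.
have [t||c] := @MVT_segment _ f df _ _ s1.
- by rewrite in_itv/= => /andP[t1 _]; apply: fdf; rewrite (lt_trans _ t1).
- apply: derivable_within_continuous => t; rewrite in_itv/= => /andP[t1 _].
  by have [] := fdf t (lt_le_trans ltr01 t1).
rewrite in_itv/= => /andP[c1 _] /eqP; rewrite subr_eq => /eqP ->.
rewrite gerDr mulr_le0_ge0 ?subr_ge0// /df pmulr_rle0 ?expR_gt0// subr_le0.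
rewrite /D besselE mulrCA ler_pM2l ?invr_gt0 ?weyl_card_gt0// mulr_sumr.
rewrite big_seq [leRHS]big_seq; apply: ler_sum => g /(mem_weyl_fset rs) Wg.
apply: ler_wpM2r; first exact: (kernel_ge0 rs ps mk dk).
rewrite -[g]trmxK -dot_mulmx; apply: (chamber_dot_max rs ps) => //.
exact: (weyl_group_inv rs).
Qed.

End bessel_on_reals.

(** * Concentration of the transition densities *)

Section lebesgue_scaling.
Variable R : realType.
Local Open Scope ereal_scope.

Lemma continuous_measurable_rV_rV m n (f : 'rV[R]_m -> 'rV[R]_n) :
  continuous f -> measurable_fun setT f.
Proof.
move=> cf; apply: (@measurability _ _ _ _ setT _ (@open 'rV[R]_n)) => //.
move=> _ [U oU <-]; rewrite setTI; apply: open_measurable_rV.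
by apply: open_comp => // v _; exact: cf.
Qed.

Lemma continuous_scale_rV n (s : R) : continuous (fun v : 'rV[R]_n => s *: v)%R.
Proof. exact: scaler_continuous. Qed.

(** The push-forward of Lebesgue measure under [x -> s x], multiplied by [s], gives half-open
    intervals their length, so it is Lebesgue measure by uniqueness. *)
Lemma ge0_integral_scale1 (s : R) (f : R -> \bar R) : (0 < s)%R ->
  measurable_fun [set: R] f -> (forall x, 0 <= f x) ->
  s%:E * \int[lebesgue_measure]_x f (s * x)%R = \int[lebesgue_measure]_x f x.
Proof.
move=> s0 mf f0.
pose phi := fun x : R => (s * x)%R.
have mphi : measurable_fun [set: measurableTypeR R] (phi : measurableTypeR R -> measurableTypeR R)
    by exact: mulrl_measurable.
have sge0 := ltW s0.
pose pm := measure_function_pushforward__canonical__measure_function_Measure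
  (@lebesgue_measure R) mphi.
pose mu : {measure set (measurableTypeR R) -> \bar R} := mscale (NngNum sge0) pm.
transitivity (\int[mu]_x f x); last first.
  apply: eq_measure_integral => A mA _; apply/esym.
  apply: (@lebesgue_measure_unique R mu) => //.
  move=> _ /ocitvP[->|[[a b] /= ab ->]]; first by rewrite !measure0.
  rewrite /mu /mscale/= /pushforward.
  rewrite (_ : phi @^-1` _ = `](a / s)%R, (b / s)%R]%classic); last first.
    apply/seteqP; split => x /=; rewrite !in_itv/= ltr_pdivrMr// ler_pdivlMr//;
      by rewrite /phi (mulrC s).
  rewrite !lebesgue_measure_itv/= !lte_fin ltr_pM2r ?invr_gt0// ab.
  by rewrite -!EFinD -EFinM; congr (_%:E); field; rewrite gt_eqF.
rewrite ge0_integral_mscale//= ge0_integral_pushforward//=.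
Qed.

Lemma ge0_integral_rV_cons n (f : 'rV[R]_n.+1 -> \bar R) :
  measurable_fun setT f -> (forall v, 0 <= f v) ->
  \int[lebesgue_rV R n.+1]_v f v =
  \int[lebesgue_measure]_x \int[lebesgue_rV R n]_v f (rV_cons (x, v)).
Proof.
move=> mf f0; rewrite /= /cons_measure ge0_integral_pushforward//=.
  rewrite preimage_setT fubini_tonelli1//.
  exact: (measurableT_comp mf (@measurable_rV_cons R n)).
exact: measurable_rV_cons.
Qed.

Lemma rV_consZ n (s : R) (p : measurableTypeR R * 'rV[R]_n) :
  (s *: rV_cons p)%R = rV_cons ((s * p.1)%R : measurableTypeR R, (s *: p.2)%R).
Proof.
apply/rowP => i; rewrite mxE.
by have [j ->|->] := unliftP ord0 i; rewrite ?rV_consS ?rV_cons0 ?mxE.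
Qed.

(** Induction on the dimension: Tonelli splits off the first coordinate, and each coordinate
    contributes one factor [s]. *)
Lemma ge0_integral_rV_scale n (s : R) (f : 'rV[R]_n -> \bar R) : (0 < s)%R ->
  measurable_fun setT f -> (forall v, 0 <= f v) ->
  (s ^+ n)%:E * \int[lebesgue_rV R n]_v f (s *: v)%R =
  \int[lebesgue_rV R n]_v f v.
Proof.
move=> s0; elim: n f => [|n ih] f mf f0.
  rewrite expr0 mul1e; apply: eq_integral => v _; congr f.
  by apply/rowP => -[].
have mfs : measurable_fun setT (fun v : 'rV[R]_n.+1 => f (s *: v)%R).
  apply: (measurableT_comp mf).
  by apply: continuous_measurable_rV_rV; exact: continuous_scale_rV.
rewrite !ge0_integral_rV_cons//.
have mfc : measurable_fun setT (fun p => f (@rV_cons R n p)).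
  exact: (measurableT_comp mf (@measurable_rV_cons R n)).
have mfsc : measurable_fun setT (fun p => f (s *: @rV_cons R n p)%R).
  exact: (measurableT_comp mfs (@measurable_rV_cons R n)).
pose H x := \int[lebesgue_rV R n]_v f (rV_cons (x, v)).
have mH : measurable_fun [set: R] H.
  exact: (@measurable_fun_fubini_tonelli_F _ _ _ _ _ (lebesgue_rV R n) _ mfc).
have H0 x : 0 <= H x by apply: integral_ge0.
rewrite -[RHS](ge0_integral_scale1 s0 mH)// exprS EFinM -muleA; congr (_ * _).
rewrite -ge0_integralZl// ?lee_fin ?exprn_ge0 ?ltW//.
  apply: eq_integral => x _; rewrite /H -[RHS]ih//.
    by under eq_integral do rewrite rV_consZ.
  exact: (measurableT_comp mfc (pair1_measurable _)).
  exact: (@measurable_fun_fubini_tonelli_F _ _ _ _ _ (lebesgue_rV R n) _ mfsc).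
by move=> x _; exact: integral_ge0.
Qed.

End lebesgue_scaling.

Section euclidean_measurability.
Variables (R : realType) (N : nat).
Implicit Types (x y : 'rV[R]_N).

Lemma enormD x y : enorm (x + y) <= enorm x + enorm y.
Proof.
rewrite -(@ler_pXn2r _ 2) ?nnegrE ?addr_ge0 ?enorm_ge0//.
rewrite sqrrD !enorm_sqr dotDl !dotDr (dotC y x) addrA -(addrA (dot x x)).
by rewrite !lerD2r lerD2l mulr2n lerD// dot_le_enorm.
Qed.

Lemma continuous_dotl y : continuous (fun x => dot x y).
Proof.
apply: continuous_sum => i x.
have ci : continuous (fun v : 'rV[R]_N => v 0 i) by exact: coord_continuous.
exact (cvgM (ci x) (@cst_continuous _ R (y 0 i) x)).
Qed.

Lemma continuous_enorm_sqr : continuous (fun x => enorm x ^+ 2).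
Proof.
rewrite (_ : (fun x => _) = (fun x => dot x x)); last first.
  by apply/funext => x; rewrite enorm_sqr.
apply: continuous_sum => i x.
have ci : continuous (fun v : 'rV[R]_N => v 0 i) by exact: coord_continuous.
exact (cvgM (ci x) (ci x)).
Qed.

Lemma continuous_enorm : continuous (@enorm R N).
Proof.
move=> x; rewrite (_ : @enorm R N = Num.sqrt \o (fun x => enorm x ^+ 2)); last first.
  by apply/funext => y /=; rewrite sqrtr_sqr ger0_norm ?enorm_ge0.
apply: continuous_comp; first exact: continuous_enorm_sqr.
exact: sqrt_continuous.
Qed.

Lemma near_enorm y (e : R) : 0 < e -> \forall x \near y, enorm (x - y) < e.
Proof.
move=> e0.
have ce : continuous (fun x => enorm (x - y)).
  move=> x; apply: (@continuous_comp _ _ _ (fun z => z - y) (@enorm R N)).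
    exact: (cvgB cvg_id (cvg_cst y)).
  exact: continuous_enorm.
apply: (cvgr_lt _ (ce y)).
by rewrite subrr enorm0.
Qed.

Lemma coord_le_enorm x i : `|x 0 i| <= enorm x.
Proof.
rewrite -(@ler_pXn2r _ 2) ?nnegrE ?enorm_ge0// enorm_sqr real_normK ?num_real//.
rewrite /dot (bigD1 i)//= -expr2 lerDl sumr_ge0// => j _.
by rewrite -expr2 sqr_ge0.
Qed.

Lemma enormN x : enorm (- x) = enorm x.
Proof. by rewrite -scaleN1r enormZ normrN1 mul1r. Qed.

Lemma measurable_weight (Phip : {fset 'rV[R]_N}) (k : 'rV[R]_N -> R) :
  measurable_fun [set: 'rV[R]_N] (weight Phip k).
Proof.
rewrite /weight; elim: (enum_fset Phip) => [|a s ih].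
  by under eq_fun do rewrite big_nil; exact: measurable_cst.
under eq_fun do rewrite big_cons.
apply: measurable_funM => //.
apply: (@measurableT_comp _ _ _ _ _ _ (fun u : R => u `^ (2 * k a))).
  exact: measurable_powR.
apply: (@measurableT_comp _ _ _ _ _ _ (@Num.norm R R)).
  exact: normr_measurable.
rewrite (_ : dot a = fun x => dot x a); last by apply/funext => x; exact: dotC.
by apply: continuous_measurable_rV; exact: continuous_dotl.
Qed.

Lemma weight_ge0 (Phip : {fset 'rV[R]_N}) (k : 'rV[R]_N -> R) x :
  0 <= weight Phip k x.
Proof. by apply: prodr_ge0 => a _; exact: powR_ge0. Qed.

End euclidean_measurability.

Lemma weightZ (R : realType) (N : nat) (Phip : {fset 'rV[R]_N}) (k : 'rV[R]_N -> R)
  (s : R) (x : 'rV[R]_N) : 0 < s ->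
  weight Phip k (s *: x) = s `^ (2 * gamma Phip k) * weight Phip k x.
Proof.
move=> s0; rewrite /weight /gamma; elim: (enum_fset Phip) => [|a r ih].
  by rewrite !big_nil mulr0 powRr0 mul1r.
rewrite !big_cons ih dotZr normrM powRM// (gtr0_norm s0) mulrDr powRD; last first.
  by rewrite (gt_eqF s0) implybT.
by ring.
Qed.

(** * Densities with drift for an abstract kernel [G], later the Dunkl kernel or the Bessel
    function *)

Section drift_concentration.
Variables (R : realType) (N : nat) (Phip : {fset 'rV[R]_N}) (k : 'rV[R]_N -> R).
Variables (S : set 'rV[R]_N) (c : R) (G : 'rV[R]_N -> 'rV[R]_N -> R) (l : 'rV[R]_N).
Implicit Types (x y z : 'rV[R]_N) (t e : R).

Local Notation p := (drift_density Phip k c G l).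
Local Notation mu := (lebesgue_rV R N).

Hypothesis mS : measurable S.
Hypothesis S0 : S 0.
Hypothesis c_ge0 : 0 <= c.
Hypothesis G0l : forall y, G 0 y = 1.
Hypothesis GZ : forall (b : R) x y, G (b *: x) y = G x (b *: y).
Hypothesis G_ge0 : forall x y, 0 <= G x y.
Hypothesis G_dist : forall x y z, `|G x y - G x z| <=
  enorm x * enorm (y - z) * expR (1 + enorm x * (enorm y + enorm z)).
Hypothesis cG : continuous (G ^~ l).
Hypothesis p_total : forall t x, 0 < t -> S x -> transition p t x S = 1%E.

Let D := gamma Phip k + N%:R / 2.
Definition drift_constant t := c * expR (- (enorm l ^+ 2 * t / 2)) / t `^ D.
Definition drift_density0 t y := drift_constant t *
  (expR (- (enorm y ^+ 2 / (2 * t))) * (G y l * weight Phip k y)).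
Local Notation A := drift_constant.
Local Notation q := drift_density0.

(** The dependence on [x] is isolated: [q t] is the density for the starting point 0, and the
    remaining factor depends on [y] only through [y / t]. *)
Lemma drift_densityE t x y : 0 < t -> p t x y =
  expR (- (enorm x ^+ 2 / (2 * t))) / G x l * (G x (t^-1 *: y) * q t y).
Proof.
move=> t0; rewrite /drift_density /q /A -/D GZ scalerA.
rewrite (_ : _^-1 * _^-1 = t^-1); last by rewrite -invfM -expr2 sqr_sqrtr// ltW.
rewrite mulrDl opprD expRD.
by ring.
Qed.

(** Total mass 1 rules out [c = 0]; for [c] proportional to [dunkl_constant], which is an inverse,
    this excludes the default value [0^-1 = 0]. *)
Lemma drift_constant_gt0 t : 0 < t -> 0 < A t.
Proof.
move=> t0; rewrite /A divr_gt0 ?powR_gt0// mulr_gt0 ?expR_gt0//.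
rewrite lt_neqAle c_ge0 andbT eq_sym; apply/eqP => c0.
have := p_total ltr01 S0; rewrite /transition.
rewrite (eq_integral (fun=> 0%E)) => [|y _]; last first.
  by rewrite drift_densityE// /q /A c0 !(mul0r, mulr0).
by rewrite integral0 => /eqP; rewrite eqe eq_sym oner_eq0.
Qed.

Lemma drift_density0_ge0 t y : 0 < t -> 0 <= q t y.
Proof.
move=> t0; rewrite mulr_ge0 ?(ltW (drift_constant_gt0 t0))//.
by rewrite !mulr_ge0 ?expR_ge0 ?weight_ge0.
Qed.

Lemma continuous_driftr x : continuous (G x).
Proof.
move=> y U /nbhs_ballP[e /= e0 eU].
pose M := enorm x * expR (1 + enorm x * (enorm y + (enorm y + 1))).
have M0 : 0 <= M by rewrite mulr_ge0 ?enorm_ge0 ?expR_ge0.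
pose r := Num.min 1 (e / (M + 1)).
have r0 : 0 < r by rewrite lt_min ltr01 divr_gt0// ltr_pwDr.
apply: filterS (near_enorm y r0) => z; rewrite lt_min => /andP[zy1 zye].
apply: eU; rewrite /ball/=; apply: le_lt_trans (G_dist _ _ _) _.
have zy : enorm (y - z) = enorm (z - y) by rewrite -opprB enormN.
apply: (@le_lt_trans _ _ (M * enorm (z - y))).
  rewrite zy mulrAC ler_wpM2r ?enorm_ge0// ler_wpM2l ?enorm_ge0//.
  rewrite ler_expR lerD2l ler_wpM2l ?enorm_ge0// lerD2l.
  by rewrite -[z](subrK y) addrC (le_trans (enormD _ _))// lerD2l ltW.
have M1 : 0 < M + 1 by rewrite ltr_pwDr.
rewrite (@le_lt_trans _ _ ((M + 1) * enorm (z - y)))//.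
  by rewrite ler_wpM2r ?enorm_ge0// lerDl.
by rewrite mulrC -ltr_pdivlMr.
Qed.

Lemma measurable_drift_density0 t : measurable_fun [set: 'rV[R]_N] (q t).
Proof.
apply: measurable_funM; first exact: measurable_cst.
apply: measurable_funM.
  apply: (@measurableT_comp _ _ _ _ _ _ expR); first exact: measurable_expR.
  rewrite (_ : (fun x => _) = (fun x => - (2 * t)^-1 * enorm x ^+ 2)); last first.
    by apply/funext => y; rewrite mulNr mulrC.
  apply: measurable_funM; first exact: measurable_cst.
  by apply: continuous_measurable_rV; exact: continuous_enorm_sqr.
apply: measurable_funM; last exact: measurable_weight.
exact: continuous_measurable_rV.
Qed.

Lemma measurable_driftr t x :
  measurable_fun [set: 'rV[R]_N] (fun y => G x (t^-1 *: y)).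
Proof.
apply: continuous_measurable_rV => y.
apply: (@continuous_comp _ _ _ (fun y => t^-1 *: y) (G x)).
  exact: scaler_continuous.
exact: continuous_driftr.
Qed.

(** If [G x l] were 0, division by it would make the density vanish identically, against total mass
    1. *)
Lemma driftl_gt0 x : S x -> 0 < G x l.
Proof.
move=> Sx; rewrite lt_neqAle G_ge0 andbT eq_sym; apply/eqP => Gx.
have := p_total ltr01 Sx; rewrite /transition.
rewrite (eq_integral (fun=> 0%E)) => [|y _]; last first.
  by rewrite drift_densityE// Gx invr0 mulr0 mul0r.
by rewrite integral0 => /eqP; rewrite eqe eq_sym oner_eq0.
Qed.

(** Total mass 1 from [x], read as the mean of [G x (X_t / t)] under the law from 0. *)
Lemma drift_integral t x : 0 < t -> S x ->
  (\int[mu]_(y in S) (G x (t^-1 *: y) * q t y)%:E =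
   (expR (enorm x ^+ 2 / (2 * t)) * G x l)%:E)%E.
Proof.
move=> t0 Sx; have Gx := driftl_gt0 Sx.
have := p_total t0 Sx; rewrite /transition.
under eq_integral do rewrite drift_densityE// EFinM.
rewrite ge0_integralZl_EFin//; last 3 first.
- by move=> y _; rewrite lee_fin mulr_ge0// drift_density0_ge0.
- apply/measurable_EFinP; apply: measurable_funTS.
  by apply: measurable_funM; [exact: measurable_driftr|exact: measurable_drift_density0].
- by rewrite divr_ge0 ?expR_ge0// ltW.
move=> h; rewrite -[LHS]mul1e.
have -> : 1%E = ((expR (enorm x ^+ 2 / (2 * t)) * G x l) *
    (expR (- (enorm x ^+ 2 / (2 * t))) / G x l))%:E.
  by rewrite expRN; congr EFin; field; rewrite !gt_eqF ?expR_gt0.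
by rewrite EFinM -muleA h mule1.
Qed.

Lemma drift_integral0 t : 0 < t -> (\int[mu]_(y in S) (q t y)%:E = 1)%E.
Proof.
move=> t0; have := drift_integral t0 S0.
rewrite enorm0 expr0n/= mul0r expR0 mul1r G0l => <-.
by apply: eq_integral => y _; rewrite G0l mul1r.
Qed.

(** For [t' = t^2 / (t - 1)] one has [1/(2t) - 1/(2t^2) = 1/(2t')], so the Gaussian factor turns
    [q t] into a multiple of [q t'], whose mass is 1. *)
Lemma drift_gaussian t : 1 < t ->
  (\int[mu]_(y in S) (expR (enorm (t^-1 *: y) ^+ 2 / 2) * q t y)%:E =
   (A t / A (t ^+ 2 / (t - 1)))%:E)%E.
Proof.
move=> t1; have t0 : 0 < t by rewrite (lt_trans _ t1).
have t1' : 0 < t - 1 by rewrite subr_gt0.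
set t' := t ^+ 2 / (t - 1); have t'0 : 0 < t' by rewrite divr_gt0// exprn_gt0.
transitivity (\int[mu]_(y in S) ((A t / A t')%:E * (q t' y)%:E))%E.
  apply: eq_integral => y _; rewrite -EFinM; congr EFin.
  rewrite /q [RHS]mulrA divfK ?gt_eqF ?drift_constant_gt0//.
  rewrite mulrCA [X in _ * X = _]mulrA -expRD enormZ ger0_norm ?invr_ge0 ?ltW//.
  congr (_ * (expR _ * _)); rewrite /t'.
  by field; rewrite !gt_eqF.
rewrite ge0_integralZl_EFin//.
- by rewrite drift_integral0// mule1.
- by move=> y _; rewrite lee_fin drift_density0_ge0.
- by apply/measurable_EFinP; apply: measurable_funTS; exact: measurable_drift_density0.
- by rewrite divr_ge0// ltW ?drift_constant_gt0.
Qed.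

Lemma drift_constant_ratio_cvg :
  A t / A (t ^+ 2 / (t - 1)) @[t --> +oo] --> expR (enorm l ^+ 2 / 2).
Proof.
pose r t := t / (t - 1).
have rcvg : r t @[t --> +oo] --> (1 : R).
  apply/cvgrPdist_le => e e0; near=> t.
  have t1 : 1 + e^-1 < t by near: t; exact: nbhs_pinfty_gt (num_real _).
  have e1 : 0 < e^-1 by rewrite invr_gt0.
  have t0 : 0 < t - 1 by lra.
  rewrite /r (_ : 1 - _ = - (t - 1)^-1); last by field; rewrite gt_eqF.
  rewrite normrN ger0_norm; last by rewrite invr_ge0 ltW.
  by rewrite invf_ple ?posrE//; apply: ltW; lra.
(* With [u = t / (t - 1)], so that [t' = t u] and [t' - t = u], the ratio equals [f u] exactly. *)
pose f u := expR (enorm l ^+ 2 / 2 * u) * u `^ D.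
have cf : f u @[u --> (1 : R)] --> f 1.
  have c1 : {for (1 : R), continuous (fun u => expR (enorm l ^+ 2 / 2 * u))}.
    apply: (@continuous_comp _ _ _ (fun u => enorm l ^+ 2 / 2 * u) expR).
      exact: (cvgM (cvg_cst _) cvg_id).
    exact: continuous_expR.
  have c2 : {for (1 : R), continuous (fun u => u `^ D)}.
    apply: differentiable_continuous; apply/derivable1_diffP.
    by have [] := is_derive1_powR D (@ltr01 R).
  exact: (cvgM c1 c2).
have := cvg_comp _ _ rcvg cf; rewrite {2}/f powR1 !mulr1.
apply: cvg_trans; apply: near_eq_cvg; near=> t => /=.
have t1 : 1 < t by near: t; exact: nbhs_pinfty_gt (num_real _).
have t0 : 0 < t by rewrite (lt_trans _ t1).
have t10 : 0 < t - 1 by rewrite subr_gt0.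
have c0 : c != 0.
  by apply/eqP => c0; have := drift_constant_gt0 t0; rewrite /A c0 !mul0r ltxx.
rewrite /f /r /A (_ : t ^+ 2 / (t - 1) = t * (t / (t - 1))); last by rewrite mulrA.
have r0 : 0 < t / (t - 1) by rewrite divr_gt0.
rewrite (@powRM _ t (t / (t - 1)))  ?ltW// (_ : enorm l ^+ 2 / 2 * (t / (t - 1)) =
    - (enorm l ^+ 2 * t / 2) + enorm l ^+ 2 * (t * (t / (t - 1))) / 2); last first.
  by field; rewrite gt_eqF.
rewrite expRD [X in _ / (_ * X / _)]expRN.
by field; rewrite c0 !gt_eqF ?powR_gt0 ?expR_gt0.
Unshelve. all: by end_near. Qed.

Definition near_drift e t y : R := (enorm (t^-1 *: y - l) <= e)%R%:R.

Lemma measurable_near_drift e t :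
  measurable_fun [set: 'rV[R]_N] (near_drift e t).
Proof.
rewrite /near_drift.
rewrite (_ : (fun y => _) = (fun u : R => (u <= e)%R%:R : R) \o (fun y => enorm (t^-1 *: y - l)))//.
apply: measurableT_comp.
  rewrite (_ : (fun u => _) = \1_(`]-oo, e]%classic)).
    exact: measurable_indic.
  by apply/funext => u; rewrite indicE mem_setE in_itv.
apply: continuous_measurable_rV => y.
apply: (@continuous_comp _ _ _ (fun y => t^-1 *: y - l) (@enorm R N)).
  apply: (@continuous_comp _ _ _ (fun y => t^-1 *: y) (fun y => y - l)).
    exact: scaler_continuous.
  exact: (cvgB cvg_id (cvg_cst l)).
exact: continuous_enorm.
Qed.

Let integrable_ge0 (f : 'rV[R]_N -> R) : measurable_fun [set: 'rV[R]_N] f ->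
  (forall y, S y -> 0 <= f y) -> (\int[mu]_(y in S) (f y)%:E < +oo)%E ->
  mu.-integrable S (EFin \o f).
Proof.
move=> mf f0 fi; apply/integrableP; split.
  by apply/measurable_EFinP; exact: measurable_funTS.
under eq_integral => y /set_mem Sy do rewrite /= ger0_norm ?f0//.
exact: fi.
Qed.

Lemma integrable_drift_density0 t : 0 < t -> mu.-integrable S (EFin \o q t).
Proof.
move=> t0; apply: integrable_ge0; first exact: measurable_drift_density0.
  by move=> y _; exact: drift_density0_ge0.
by rewrite drift_integral0// ltry.
Qed.

Lemma near_drift_ge0 e t y : 0 <= near_drift e t y.
Proof. exact: ler0n. Qed.

Lemma near_drift_le1 e t y : near_drift e t y <= 1.
Proof. by rewrite /near_drift lern1; case: (_ <= _). Qed.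

Lemma integrable_near_drift e t : 0 < t ->
  mu.-integrable S (fun y => (near_drift e t y * q t y)%:E).
Proof.
move=> t0; apply: integrable_ge0 => [|y Sy|].
- by apply: measurable_funM; [exact: measurable_near_drift|exact: measurable_drift_density0].
- by rewrite mulr_ge0 ?drift_density0_ge0// near_drift_ge0.
apply: (@le_lt_trans _ _ 1%E); last by rewrite ltry.
rewrite -(drift_integral0 t0); apply: ge0_le_integral => //.
- by move=> y Sy; rewrite lee_fin mulr_ge0 ?drift_density0_ge0// near_drift_ge0.
- apply/measurable_EFinP; apply: measurable_funTS.
  by apply: measurable_funM; [exact: measurable_near_drift|exact: measurable_drift_density0].
- by apply/measurable_EFinP; apply: measurable_funTS; exact: measurable_drift_density0.
- move=> y Sy; rewrite lee_fin ler_piMl ?drift_density0_ge0//.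
  exact: near_drift_le1.
Qed.

Lemma measurable_gaussian_drift t : measurable_fun [set: 'rV[R]_N]
  (fun y => expR (enorm (t^-1 *: y) ^+ 2 / 2) * q t y).
Proof.
apply: measurable_funM; last exact: measurable_drift_density0.
apply: (@measurableT_comp _ _ _ _ _ _ expR); first exact: measurable_expR.
apply: measurable_funM; last exact: measurable_cst.
apply: continuous_measurable_rV => y.
apply: (@continuous_comp _ _ _ (fun y => t^-1 *: y) (fun y => enorm y ^+ 2)).
  exact: scaler_continuous.
exact: continuous_enorm_sqr.
Qed.

Lemma integrable_gaussian_drift t : 1 < t -> mu.-integrable S
  (fun y => (expR (enorm (t^-1 *: y) ^+ 2 / 2) * q t y)%:E).
Proof.
move=> t1; have t0 : 0 < t by rewrite (lt_trans _ t1).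
apply: integrable_ge0 => [|y _|]; first exact: measurable_gaussian_drift.
  by rewrite mulr_ge0 ?expR_ge0 ?drift_density0_ge0.
by rewrite drift_gaussian// ltry.
Qed.

Definition concentrated0 := forall e eta, 0 < e -> 0 < eta ->
  \forall t \near +oo,
    ((1 - eta)%:E <= \int[mu]_(y in S) (near_drift e t y * q t y)%:E)%E.

(** The mean of [T] is at least 1, while the mean of its exponential bound tends to 1. Outside the
    ball of radius [e] the two functions differ by at least [kap e], so [kap e] times the mass there
    is at most the vanishing difference of the means. *)
Lemma concentration_of_test (T : 'rV[R]_N -> R) (kap : R -> R) :
  (forall e, 0 < e -> 0 < kap e) ->
  (forall t, 1 < t -> mu.-integrable S (fun y => (T (t^-1 *: y) * q t y)%:E)) ->
  (forall t, 1 < t -> (1 <= \int[mu]_(y in S) (T (t^-1 *: y) * q t y)%:E)%E) ->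
  (forall z, T z <= expR ((enorm z ^+ 2 - enorm l ^+ 2) / 2)) ->
  (forall e z, 0 < e -> e < enorm (z - l) ->
    T z + kap e <= expR ((enorm z ^+ 2 - enorm l ^+ 2) / 2)) ->
  concentrated0.
Proof.
move=> kap0 Ti T1 Tle Tkap e eta e0 eta0.
(* [B t] is the mean of [expR ((|Z|^2 - |l|^2) / 2)] for [Z = X_t / t] started at 0. *)
pose B t := expR (- (enorm l ^+ 2 / 2)) * (A t / A (t ^+ 2 / (t - 1))).
have Bcvg : B t @[t --> +oo] --> (1 : R).
  rewrite (_ : 1 = expR (- (enorm l ^+ 2 / 2)) * expR (enorm l ^+ 2 / 2)); last first.
    by rewrite -expRD addrC subrr expR0.
  exact: (cvgM (cvg_cst _) drift_constant_ratio_cvg).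
have ke0 : 0 < kap e * eta by rewrite mulr_gt0 ?kap0.
near=> t.
have t1 : 1 < t by near: t; exact: nbhs_pinfty_gt (num_real _).
have t0 : 0 < t by rewrite (lt_trans _ t1).
have Bt : B t < 1 + kap e * eta.
  by near: t; apply: (cvgr_lt _ Bcvg); rewrite ltrDl.
have qi := integrable_drift_density0 t0.
have ni := integrable_near_drift e t0.
have Gi := integrable_gaussian_drift t1.
(* Pointwise comparison: inside the ball [kap e] is added on both sides, outside it is the assumed
   gap. *)
have key : (\int[mu]_(y in S) ((T (t^-1 *: y) * q t y)%:E + (kap e)%:E * (q t y)%:E) <=
    \int[mu]_(y in S) ((expR (- (enorm l ^+ 2 / 2)))%:E *
      (expR (enorm (t^-1 *: y) ^+ 2 / 2) * q t y)%:E +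
      (kap e)%:E * (near_drift e t y * q t y)%:E))%E.
  apply: le_integral => //.
  - by apply: integrableD => //; [exact: Ti|exact: integrableZl].
  - by apply: integrableD => //; exact: integrableZl.
  move=> y _; rewrite -!EFinM -!EFinD lee_fin [in leRHS]mulrA -expRD.
  rewrite [in leRHS](mulrA (kap e)) -!mulrDl.
  apply: ler_wpM2r; first exact: drift_density0_ge0.
  rewrite [X in expR X](_ : _ = (enorm (t^-1 *: y) ^+ 2 - enorm l ^+ 2) / 2); last first.
    by rewrite mulrBl addrC.
  rewrite /near_drift; case: (leP (enorm (t^-1 *: y - l)) e) => h; first by rewrite mulr1 lerD2r.
  by rewrite mulr0 addr0; exact: Tkap.
move: key; rewrite integralD//=; [|exact: Ti|exact: integrableZl].
rewrite integralD//=; [|exact: integrableZl|exact: integrableZl].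
rewrite !integralZl// drift_gaussian// drift_integral0// mule1 -EFinM -/(B t).
have := T1 t t1; have := integrable_fin_num mS (Ti t t1).
have := integrable_fin_num mS ni.
case: (\int[mu]_(_ in S) (T _ * _)%:E)%E => [i1| |]//.
case: (\int[mu]_(_ in S) (near_drift _ _ _ * _)%:E)%E => [i2| |]// _ _.
rewrite -EFinM -!EFinD !lee_fin => i11 h.
have : kap e * (1 - eta) <= kap e * i2 by lra.
by rewrite ler_pM2l// kap0.
Unshelve. all: by end_near. Qed.

(** Near [l] and for large [t], the density of the law from [x] relative to the law from 0 is at
    least [(1 - d)^2], so concentration carries over. *)
Lemma drift_concentration x e eta : concentrated0 -> S x -> 0 < e -> 0 < eta ->
  \forall t \near +oo,
    ((1 - eta)%:E <= \int[mu]_(y in S) (near_drift e t y * p t x y)%:E)%E.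
Proof.
move=> c0 Sx e0 eta0; have Gx := driftl_gt0 Sx.
(* Three factors [1 - d] are lost: to the mass near [l], to [G x z / G x l] and to the Gaussian
   factor. Then [(1 - d)^3 >= 1 - 3 d], and [d <= 1] keeps the factors non-negative. *)
pose d := Num.min (eta / 3) 1.
have d0 : 0 < d by rewrite lt_min ltr01 divr_gt0.
have d1 : d <= 1 by rewrite ge_min lexx orbT.
have de : d * 3 <= eta by rewrite -ler_pdivlMr// ge_min lexx.
have [e' e'0 He'] : exists2 e', 0 < e' & forall z, enorm (z - l) <= e' ->
    enorm (z - l) <= e /\ (1 - d) * G x l <= G x z.
  have : \forall z \near l, (1 - d) * G x l < G x z.
    apply: (cvgr_gt _ (@continuous_driftr x l)).
    by rewrite gtr_pMl// gtrBl.
  (* The neighbourhood is a ball of the sup norm, which [enorm] dominates; the half turns [<=] into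
     [<]. *)
  move=> /nbhs_ballP[r /= r0 rG]; exists (Num.min e (r / 2)).
    by rewrite lt_min e0 divr_gt0.
  move=> z; rewrite le_min => /andP[ze zr]; split => //.
  apply/ltW/rG; split => // i j; rewrite ord1 /ball/=.
  have := le_trans (coord_le_enorm (z - l) j) zr; rewrite !mxE distrC => h.
  by rewrite (le_lt_trans h)// ltr_pdivrMr// ltr_pMr// ltr1n.
near=> t.
have t0 : 0 < t by near: t; exact: nbhs_pinfty_gt (num_real _).
have tx : enorm x ^+ 2 / (2 * d) < t by near: t; exact: nbhs_pinfty_gt (num_real _).
have ct : ((1 - d)%:E <= \int[mu]_(y in S) (near_drift e' t y * q t y)%:E)%E.
  by near: t; exact: c0.
have xd : 1 - d <= expR (- (enorm x ^+ 2 / (2 * t))).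
  rewrite (le_trans _ (expR_ge1Dx _))// lerD2l lerN2.
  move: tx; rewrite ltr_pdivrMr ?mulr_gt0// => /ltW tx.
  by rewrite ler_pdivrMr ?mulr_gt0// (le_trans tx)// le_eqVlt; apply/orP; left; apply/eqP; ring.
have d10 : 0 <= 1 - d by rewrite subr_ge0.
apply: (@le_trans _ _ (((1 - d) ^+ 2)%:E *
    \int[mu]_(y in S) (near_drift e' t y * q t y)%:E)%E).
  apply: (@le_trans _ _ (((1 - d) ^+ 2)%:E * (1 - d)%:E)%E); last first.
    by apply: lee_wpmul2l => //; rewrite lee_fin sqr_ge0.
  rewrite -EFinM lee_fin; nra.
have q0 y : 0 <= q t y by exact: drift_density0_ge0.
rewrite -ge0_integralZl_EFin ?sqr_ge0//; last 2 first.
- by move=> y _; rewrite lee_fin mulr_ge0 ?near_drift_ge0.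
- apply/measurable_EFinP; apply: measurable_funTS.
  by apply: measurable_funM; [exact: measurable_near_drift|exact: measurable_drift_density0].
apply: ge0_le_integral => //.
- move=> y _; rewrite -EFinM lee_fin mulr_ge0 ?sqr_ge0// mulr_ge0 ?near_drift_ge0//.
- apply/measurable_EFinP; apply: measurable_funTS.
  apply: measurable_funM; first exact: measurable_cst.
  by apply: measurable_funM; [exact: measurable_near_drift|exact: measurable_drift_density0].
- apply/measurable_EFinP; apply: measurable_funTS.
  apply: measurable_funM; first exact: measurable_near_drift.
  rewrite (_ : p t x = fun y => expR (- (enorm x ^+ 2 / (2 * t))) / G x l *
    (G x (t^-1 *: y) * q t y)); last by apply/funext => y; rewrite drift_densityE.
  apply: measurable_funM; first exact: measurable_cst.
  by apply: measurable_funM; [exact: measurable_driftr|exact: measurable_drift_density0].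
move=> y _; rewrite -EFinM lee_fin drift_densityE// /near_drift.
have Gy := G_ge0 x (t^-1 *: y).
have [/He'[-> GG]|_] := leP (enorm (t^-1 *: y - l)) e'; last first.
  rewrite mul0r mulr0; apply: mulr_ge0; first exact: ler0n.
  apply: mulr_ge0; first by rewrite divr_ge0 ?expR_ge0 ?G_ge0.
  by rewrite mulr_ge0 ?G_ge0.
rewrite !mul1r mulrA ler_wpM2r// expr2 -mulrA.
by rewrite ler_pM// [leRHS]mulrC ler_pdivlMr.
Unshelve. all: by end_near. Qed.

Lemma dot_le_exponent z :
  dot z l - enorm l ^+ 2 <= (enorm z ^+ 2 - enorm l ^+ 2) / 2.
Proof.
have := dot_ge0 (z - l); rewrite !enorm_sqr dotBl !dotBr (dotC l z); lra.
Qed.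

Let dot_exponent z : dot z l - enorm l ^+ 2 =
  (enorm z ^+ 2 - enorm l ^+ 2) / 2 - enorm (z - l) ^+ 2 / 2.
Proof. by rewrite !enorm_sqr dotBl !dotBr (dotC l z); field. Qed.

Let expR_test z := expR (dot z l - enorm l ^+ 2).

Let measurable_expR_test t :
  measurable_fun [set: 'rV[R]_N] (fun y => expR_test (t^-1 *: y) * q t y).
Proof.
apply: measurable_funM; last exact: measurable_drift_density0.
apply: (@measurableT_comp _ _ _ _ _ _ expR); first exact: measurable_expR.
apply: measurable_funB; last exact: measurable_cst.
apply: continuous_measurable_rV => y.
apply: (@continuous_comp _ _ _ (fun y => t^-1 *: y) (fun y => dot y l)).
  exact: scaler_continuous.
exact: continuous_dotl.
Qed.

(* Scaling the total mass identity of [q] by s = 1 + 1/t. *)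
Lemma drift_exponential_moment t :
  (forall b y, 0 < b -> S y -> S (b *: y)) ->
  (forall s y, S y -> 1 <= s -> G (s *: y) l <= expR ((s - 1) * dot y l) * G y l) ->
  0 < t -> (1 <= \int[mu]_(y in S) (expR_test (t^-1 *: y) * q t y)%:E)%E.
Proof.
move=> coneS growth t0; pose s := 1 + t^-1.
have s1 : 1 <= s by rewrite lerDl invr_ge0 ltW.
have s0 : 0 < s := lt_le_trans ltr01 s1.
(* This [t'] makes [|s y|^2 / (2 t') = |y|^2 / (2 t)], so the scaled Gaussian is that of [q t]. *)
pose t' := t * s ^+ 2; have t'0 : 0 < t' by rewrite mulr_gt0// exprn_gt0.
pose f y : \bar R := ((fun y => (q t' y)%:E) \_ S) y.
have f0 y : (0 <= f y)%E.
  by apply: erestrict_ge0 => {}y _; rewrite lee_fin drift_density0_ge0.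
have mf : measurable_fun [set: 'rV[R]_N] f.
  apply/(measurable_restrictT _ _).1 => //.
  by apply/measurable_EFinP; apply: measurable_funTS; exact: measurable_drift_density0.
have := ge0_integral_rV_scale s0 mf f0.
rewrite [RHS](_ : _ = 1%E); last first.
  by rewrite -integral_mkcond drift_integral0.
move=> <-; rewrite -ge0_integralZl//; last 2 first.
- apply: (measurableT_comp mf).
  by apply: continuous_measurable_rV_rV; exact: continuous_scale_rV.
- by rewrite lee_fin exprn_ge0// ltW.
rewrite [leRHS]integral_mkcond; apply: ge0_le_integral => //.
- by move=> y _; rewrite mule_ge0// lee_fin exprn_ge0// ltW.
- apply: emeasurable_funM; first exact: measurable_cst.
  apply: (measurableT_comp mf).
  by apply: continuous_measurable_rV_rV; exact: continuous_scale_rV.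
- apply/(measurable_restrictT _ _).1 => //.
  by apply/measurable_EFinP; apply: measurable_funTS; exact: measurable_expR_test.
move=> y _; rewrite /f !patchE.
have -> : (s *: y \in S) = (y \in S).
  apply/idP/idP => /set_mem Sy; apply/mem_set; last exact: coneS.
  by rewrite -[y]scale1r -(mulVf (lt0r_neq0 s0)) -scalerA; apply: coneS => //; rewrite invr_gt0.
case: ifPn => [/set_mem Sy|_]; last by rewrite mule0.
rewrite -EFinM lee_fin.
(* Lebesgue measure and the weight contribute [s^(2 D)], cancelling the power of [s] in [A t']; the
   exponential comes from [t s^2 = t + 2 + 1/t]. *)
have At' : s ^+ N * (s `^ (2 * gamma Phip k) * A t') =
    expR (- (enorm l ^+ 2 * (2 + t^-1) / 2)) * A t.
  have -> : s ^+ N = s `^ (2 * (N%:R / 2)) by rewrite mulrC divfK// powR_mulrn// ltW.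
  rewrite [LHS]mulrA -powRD; last by rewrite (gt_eqF s0) implybT.
  rewrite -mulrDr (addrC (N%:R / 2)) -/D /A /t' (@powRM _ t (s ^+ 2)) ?exprn_ge0 ?ltW//.
  rewrite (_ : (s ^+ 2) `^ D = s `^ (2 * D)); last by rewrite powRrM powR_mulrn ?ltW.
  rewrite (_ : enorm l ^+ 2 * (t * s ^+ 2) / 2 = enorm l ^+ 2 * (2 + t^-1) / 2 + enorm l ^+ 2 * t / 2); last first.
    by rewrite /s; field; rewrite gt_eqF.
  rewrite opprD expRD; field.
  by rewrite !gt_eqF ?powR_gt0.
have -> : s ^+ N * q t' (s *: y) = s ^+ N * (s `^ (2 * gamma Phip k) * A t') *
    (expR (- (enorm y ^+ 2 / (2 * t))) * (G (s *: y) l * weight Phip k y)).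
  rewrite /q weightZ// enormZ (gtr0_norm s0) exprMn.
  rewrite (_ : s ^+ 2 * _ / _ = enorm y ^+ 2 / (2 * t)); last first.
    by rewrite /t'; field; rewrite !gt_eqF.
  by ring.
rewrite At' /q /expR_test dotZl expRD.
have hL : expR (- (enorm l ^+ 2 * (2 + t^-1) / 2)) <= expR (- enorm l ^+ 2).
  rewrite ler_expR lerN2.
  have : 0 <= enorm l ^+ 2 * t^-1 by rewrite mulr_ge0 ?sqr_ge0// invr_ge0 ltW.
  lra.
have hG := growth s y Sy s1.
rewrite (_ : s - 1 = t^-1) in hG; last by rewrite /s addrAC subrr add0r.
have w0 := weight_ge0 Phip k y.
have A0 := ltW (drift_constant_gt0 t0).
rewrite [leRHS](_ : _ = expR (- enorm l ^+ 2) * A t * (expR (- (enorm y ^+ 2 / (2 * t))) *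
   (expR (t^-1 * dot y l) * G y l * weight Phip k y))); last by ring.
apply: ler_pM.
- by rewrite mulr_ge0 ?expR_ge0.
- by rewrite !mulr_ge0 ?expR_ge0.
- exact: ler_wpM2r.
- by rewrite ler_wpM2l ?expR_ge0// ler_wpM2r.
Qed.

Lemma concentration_of_radial_growth :
  (forall b y, 0 < b -> S y -> S (b *: y)) ->
  (forall s y, S y -> 1 <= s -> G (s *: y) l <= expR ((s - 1) * dot y l) * G y l) ->
  concentrated0.
Proof.
move=> coneS growth.
(* The gap is the exponential bound times [1 - expR (- |z - l|^2 / 2)]; the bound is smallest at
   [z = 0], with value [expR (- |l|^2 / 2)]. *)
pose kap e := expR (- (enorm l ^+ 2 / 2)) * (1 - expR (- (e ^+ 2 / 2))).
apply: (@concentration_of_test expR_test kap).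
- move=> e e0; rewrite mulr_gt0 ?expR_gt0// subr_gt0 expR_lt1 oppr_lt0.
  by rewrite divr_gt0// exprn_gt0.
- move=> t t1; have t0 : 0 < t by rewrite (lt_trans _ t1).
  apply: integrable_ge0 => [|y _|]; first exact: measurable_expR_test.
    by rewrite mulr_ge0 ?expR_ge0 ?drift_density0_ge0.
  apply: (@le_lt_trans _ _ (\int[mu]_(y in S) (expR (enorm (t^-1 *: y) ^+ 2 / 2) * q t y)%:E)%E).
    apply: ge0_le_integral => //.
    + by move=> y _; rewrite lee_fin mulr_ge0 ?expR_ge0 ?drift_density0_ge0.
    + by apply/measurable_EFinP; apply: measurable_funTS; exact: measurable_expR_test.
    + apply/measurable_EFinP; apply: measurable_funTS.
      exact: measurable_gaussian_drift.
    + move=> y _; rewrite lee_fin ler_wpM2r ?drift_density0_ge0// ler_expR.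
      rewrite (le_trans (dot_le_exponent _))// ler_pM2r// gerBl sqr_ge0//.
  by rewrite drift_gaussian// ltry.
- move=> t t1; apply: drift_exponential_moment => //.
  by rewrite (lt_trans _ t1).
- by move=> z; rewrite ler_expR dot_le_exponent.
- move=> e z e0 ez; rewrite /expR_test dot_exponent expRD /kap.
  have ab : expR (- (enorm l ^+ 2 / 2)) <= expR ((enorm z ^+ 2 - enorm l ^+ 2) / 2).
    by rewrite ler_expR; have := sqr_ge0 (enorm z); lra.
  have uv : expR (- (enorm (z - l) ^+ 2 / 2)) <= expR (- (e ^+ 2 / 2)).
    by rewrite ler_expR lerN2 ler_pM2r// ler_pXn2r ?nnegrE ?enorm_ge0 ?ltW.
  have v1 : expR (- (e ^+ 2 / 2)) <= 1.
    by rewrite expR_le1 oppr_le0 divr_ge0 ?sqr_ge0.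
  move: ab uv v1 (expR_ge0 (- (enorm l ^+ 2 / 2))); nra.
Qed.

(** * The first moment, from difference quotients of [G] at the origin *)

Section first_moment.
Variables (I : Type) (r : seq I) (b : I -> R) (v : I -> 'rV[R]_N).
Hypothesis S_all : forall x, S x.
Let step n : R := n.+1%:R^-1.
Let quotient n z := \sum_(i <- r) b i * ((G (step n *: v i) z - 1) / step n).
Hypothesis quotient_cvg : forall z, quotient n z @[n --> \oo] --> dot z l.

Let step_gt0 n : 0 < step n.
Proof. by rewrite invr_gt0 ltr0n. Qed.

Let step_le1 n : step n <= 1.
Proof. by rewrite invf_le1 ?ltr0n// ler1n. Qed.

Let step_cvg : step n @[n --> \oo] --> (0 : R).
Proof. exact: cvg_harmonic. Qed.

Let Gx0 x : G x 0 = 1.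
Proof. by rewrite -(scale0r 0) -GZ scale0r G0l. Qed.

Let C := \sum_(i <- r) `|b i| * expR (1 + 2 * enorm (v i) ^+ 2).

(** A bound uniform in [n], integrable against [q t] by [integrable_gaussian_drift]. It uses
    [|v| |z| <= expR (|v| |z|)] and [2 |v| |z| <= 2 |v|^2 + |z|^2 / 2]. *)
Let quotient_le n z : `|quotient n z| <= C * expR (enorm z ^+ 2 / 2).
Proof.
rewrite (le_trans (ler_norm_sum _ _ _))// mulr_suml; apply: ler_sum => i _.
rewrite normrM -mulrA ler_wpM2l// normrM normfV (gtr0_norm (step_gt0 n)).
rewrite ler_pdivrMr// -{1}(Gx0 (step n *: v i)).
rewrite (le_trans (G_dist _ _ _))// subr0 enorm0 addr0 enormZ (gtr0_norm (step_gt0 n)).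
set w := enorm (v i); set u := enorm z.
have w0 : 0 <= w by exact: enorm_ge0.
have u0 : 0 <= u by exact: enorm_ge0.
have wu0 : 0 <= w * u by rewrite mulr_ge0.
rewrite [leRHS]mulrC -!mulrA ler_pM2l//.
apply: (@le_trans _ _ (expR (w * u) * expR (1 + w * u))).
  rewrite mulrA; apply: ler_pM; rewrite ?expR_ge0//.
    by rewrite (le_trans _ (expR_ge1Dx _))// lerDr.
  by rewrite ler_expR lerD2l ler_piMl.
rewrite -!expRD ler_expR; have := sqr_ge0 (u - 2 * w); lra.
Qed.

(** Integrability and value are bundled so that linearity carries no separate finiteness
    conditions. *)
Let has_integral (f : 'rV[R]_N -> R) (u : R) :=
  mu.-integrable S (fun y => (f y)%:E) /\
  (\int[mu]_(y in S) (f y)%:E = u%:E)%E.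

Let has_integralD f g u w : has_integral f u -> has_integral g w ->
  has_integral (fun y => f y + g y) (u + w).
Proof.
move=> [fi fu] [gi gw]; split.
  by apply: eq_integrable (integrableD mS fi gi) => // y _; rewrite EFinD.
under eq_integral do rewrite EFinD.
by rewrite integralD// fu gw.
Qed.

Let has_integralZ (a : R) f u : has_integral f u ->
  has_integral (fun y => a * f y) (a * u).
Proof.
move=> [fi fu]; split.
  by apply: eq_integrable (integrableZl mS a fi) => // y _; rewrite EFinM.
under eq_integral do rewrite EFinM.
by rewrite integralZl// fu.
Qed.

Let has_integral_drift t x : 0 < t -> has_integral
  (fun y => G x (t^-1 *: y) * q t y) (expR (enorm x ^+ 2 / (2 * t)) * G x l).
Proof.
move=> t0; split; last by apply: drift_integral => //; exact: S_all.
apply: integrable_ge0 => [|y _|].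
- by apply: measurable_funM; [exact: measurable_driftr|exact: measurable_drift_density0].
- by rewrite mulr_ge0 ?drift_density0_ge0.
- by rewrite drift_integral ?ltry//; exact: S_all.
Qed.

(** The mean of each quotient is known exactly, by linearity from [drift_integral]. *)
Let has_integral_quotient n t : 0 < t ->
  has_integral (fun y => quotient n (t^-1 *: y) * q t y)
   (\sum_(i <- r) b i * ((expR (enorm (step n *: v i) ^+ 2 / (2 * t)) *
     G (step n *: v i) l - 1) / step n)).
Proof.
move=> t0; rewrite /quotient.
have q1 : has_integral (q t) 1.
  by split; [exact: integrable_drift_density0|rewrite drift_integral0].
elim: r => [|i s ih].
  have := has_integralZ 0 q1; rewrite mul0r big_nil; congr has_integral.
  by apply/funext => y; rewrite big_nil.
rewrite big_cons.
have h1 := has_integralZ (b i / step n)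
  (has_integralD (has_integral_drift (step n *: v i) t0) (has_integralZ (-1) q1)).
have := has_integralD h1 ih; congr has_integral.
  by apply/funext => y; rewrite big_cons; ring.
by congr (_ + _); ring.
Qed.

(** Replacing the exponential factor by 1 leaves [quotient n l], which tends to [dot l l] by
    hypothesis. The remainder is of order [step n], because the exponent is quadratic in
    [step n]. *)
Let quotient_moment_cvg t : 0 < t ->
  \sum_(i <- r) b i * ((expR (enorm (step n *: v i) ^+ 2 / (2 * t)) *
     G (step n *: v i) l - 1) / step n) @[n --> \oo] --> dot l l.
Proof.
move=> t0.
pose c' i := enorm (v i) ^+ 2 / (2 * t).
pose rest n := \sum_(i <- r) b i *
  ((expR (step n ^+ 2 * c' i) - 1) / step n * G (step n *: v i) l).
rewrite (_ : (fun n => _) = (fun n => quotient n l + rest n)); last first.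
  apply/funext => n; rewrite /quotient /rest -big_split; apply: eq_bigr => i _.
  rewrite (_ : enorm (step n *: v i) ^+ 2 / (2 * t) = step n ^+ 2 * c' i); last first.
    by rewrite enormZ (gtr0_norm (step_gt0 n)) exprMn /c' mulrA.
  by rewrite /=; ring.
rewrite -[X in _ --> X]addr0; apply: cvgD; first exact: quotient_cvg.
pose M i := 1 + enorm (v i) * enorm l * expR (1 + enorm (v i) * enorm l).
pose K := \sum_(i <- r) `|b i| * (c' i * expR (c' i) * M i).
have rest_le n : `|rest n| <= step n * K.
  rewrite (le_trans (ler_norm_sum _ _ _))// mulr_sumr; apply: ler_sum => i _.
  have c'0 : 0 <= c' i by rewrite divr_ge0 ?sqr_ge0// mulr_ge0// ltW.
  have s0 := step_gt0 n; have s1 := step_le1 n.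
  rewrite normrM [leRHS]mulrCA ler_wpM2l// normrM [leRHS]mulrA.
  apply: ler_pM => //.
    have e1 : 1 <= expR (step n ^+ 2 * c' i).
      by rewrite -expR0 ler_expR mulr_ge0// sqr_ge0.
    rewrite normrM normfV (gtr0_norm s0) ger0_norm ?subr_ge0// ler_pdivrMr//.
    have e2 : expR (step n ^+ 2 * c' i) <= expR (c' i).
      by rewrite ler_expR ler_piMl// expr_le1// ltW.
    apply: (@le_trans _ _ (step n ^+ 2 * c' i * expR (step n ^+ 2 * c' i))).
      have := expR_ge1Dx (- (step n ^+ 2 * c' i)).
      rewrite -(ler_pM2r (expR_gt0 (step n ^+ 2 * c' i))) -expRD addNr expR0; lra.
    rewrite [leRHS](_ : _ = step n ^+ 2 * c' i * expR (c' i)); last by ring.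
    by rewrite ler_wpM2l// mulr_ge0// sqr_ge0.
  have := G_dist (step n *: v i) l 0.
  rewrite Gx0 subr0 enorm0 addr0 enormZ (gtr0_norm s0) => h.
  rewrite ger0_norm// -[leLHS](subrK 1) addrC lerD2l.
  rewrite (le_trans (ler_norm _))// (le_trans h)//.
  have s0' := ltW s0.
  apply: ler_pM; rewrite ?expR_ge0 ?mulr_ge0 ?enorm_ge0//.
    by rewrite ler_wpM2r ?enorm_ge0// ler_piMl ?enorm_ge0.
  rewrite ler_expR lerD2l ler_wpM2r ?enorm_ge0// ler_piMl ?enorm_ge0//.
apply: (@squeeze_cvgr _ _ _ _ (fun n => - (step n * K)) (fun n => step n * K)).
- by apply: nearW => n; rewrite -ler_norml.
- rewrite -oppr0 -(mul0r K); apply: cvgN.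
  exact (cvgM step_cvg (cvg_cst K)).
- rewrite -(mul0r K).
  exact (cvgM step_cvg (cvg_cst K)).
Qed.

(** Dominated convergence in [n] at fixed [t]: the quotients tend to [<Z, l>] and their means to
    [<l, l>]. *)
Let first_moment t : 1 < t -> has_integral (fun y => dot (t^-1 *: y) l * q t y) (dot l l).
Proof.
move=> t1; have t0 : 0 < t by rewrite (lt_trans _ t1).
have [] := @dominated_convergence _ _ _ mu S mS
  (fun n y => (quotient n (t^-1 *: y) * q t y)%:E)
  (fun y => (dot (t^-1 *: y) l * q t y)%:E)
  (fun y => (C * (expR (enorm (t^-1 *: y) ^+ 2 / 2) * q t y))%:E).
- by move=> n; have [[/integrableP[]]] := has_integral_quotient n t0.
- apply/measurable_EFinP; apply: measurable_funTS; apply: measurable_funM; last first.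
    exact: measurable_drift_density0.
  apply: continuous_measurable_rV => y.
  apply: (@continuous_comp _ _ _ (fun y => t^-1 *: y) (fun y => dot y l)).
    exact: scaler_continuous.
  exact: continuous_dotl.
- apply: aeW => y _; apply: cvg_EFin; first exact: nearW.
  exact (cvgM (@quotient_cvg (t^-1 *: y)) (cvg_cst (q t y))).
- under eq_fun do rewrite EFinM.
  by apply: integrableZl => //; exact: integrable_gaussian_drift.
- apply: aeW => y n _ /=; rewrite lee_fin normrM mulrA.
  rewrite (ger0_norm (drift_density0_ge0 _ t0)) ler_wpM2r ?drift_density0_ge0//.
move=> ii _ cvI; split => //.
rewrite -(cvg_lim _ cvI)//; apply: cvg_lim => //.
rewrite (_ : (fun n => _) = EFin \o (fun n => \sum_(i <- r) b i *
    ((expR (enorm (step n *: v i) ^+ 2 / (2 * t)) * G (step n *: v i) l - 1) / step n))).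
  by apply: cvg_EFin; [exact: nearW|exact: quotient_moment_cvg].
by apply/funext => n; have [_ ->] := has_integral_quotient n t0.
Qed.

(** The test function is the linear part of the exponential: its mean is exactly 1, and
    [expR u >= 1 + u] leaves the gap [|z - l|^2 / 2]. *)
Lemma concentration_of_first_moment : concentrated0.
Proof.
have test t : 1 < t ->
    has_integral (fun y => (1 + dot (t^-1 *: y) l - dot l l) * q t y) 1.
  move=> t1; have t0 : 0 < t by rewrite (lt_trans _ t1).
  have q1 : has_integral (q t) 1.
    by split; [exact: integrable_drift_density0|rewrite drift_integral0].
  have := has_integralD (first_moment t1) (has_integralZ (1 - dot l l) q1).
  by congr has_integral; [apply/funext => y|]; ring.
apply: (@concentration_of_test (fun z => 1 + dot z l - dot l l) (fun e => e ^+ 2 / 2)).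
- by move=> e e0; rewrite divr_gt0// exprn_gt0.
- by move=> t /test[].
- by move=> t /test[_ ->].
- move=> z; rewrite (le_trans _ (expR_ge1Dx _))//.
  have := dot_exponent z; have := sqr_ge0 (enorm (z - l)); rewrite -enorm_sqr; lra.
- move=> e z e0 ez; rewrite (le_trans _ (expR_ge1Dx _))//.
  have : e ^+ 2 <= enorm (z - l) ^+ 2.
    by rewrite ler_pXn2r ?nnegrE ?enorm_ge0 ?ltW.
  have := dot_exponent z; rewrite -enorm_sqr; lra.
Qed.

End first_moment.

End drift_concentration.

(** * First-order expansion of the Dunkl kernel at the origin *)

Section kernel_first_order.
Variables (R : realType) (N : nat) (Phi Phip : {fset 'rV[R]_N}).
Variables (k : 'rV[R]_N -> R) (E : 'rV[R[i]]_N -> 'rV[R[i]]_N -> R[i]).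
Hypothesis dk : is_dunkl_kernel Phip k E.
Implicit Types (x y z l : 'rV[R]_N).

Local Notation F := (on_reals E).

Lemma derivable_cvg_quotient (u : R -> R) (x_ : nat -> R) : derivable u 0 1 ->
  x_ n @[n --> \oo] --> (0 : R) -> (forall n, x_ n != 0) ->
  (u (x_ n) - u 0) / x_ n @[n --> \oo] --> 'D_1 u 0.
Proof.
move=> du xcvg x0.
have xcvg' : x_ n @[n --> \oo] --> (0 : R)^'.
  move=> U [e /= e0 eU].
  have h : \forall n \near \oo, ball (0 : R) e (x_ n).
    exact: xcvg _ (nbhsx_ballx (0 : R) e e0).
  suff : \forall n \near \oo, U (x_ n) by [].
  by apply: filterS h => n xn; apply: eU.
have := cvg_comp _ _ xcvg' du.
apply: cvg_trans; apply: near_eq_cvg; near=> n => /=.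
by rewrite addr0 [_%:A]mulr1 mulrC.
Unshelve. all: by end_near. Qed.

(** [None] stands for the node [l], whose coefficient collects its own derivative and its share of
    every reflection difference; [Some a] stands for the reflected node. *)
Definition first_order_coef (i : option 'rV[R]_N) : R :=
  if i is Some a then - k a else 1 + gamma Phip k.

Definition first_order_node l (i : option 'rV[R]_N) : 'rV[R]_N :=
  if i is Some a then l *m reflection a else l.

(* The Dunkl equation at the origin: if [D x] denotes the derivative at 0 of
   [F (s x) z], then D l + sum_a k_a (D l - D (l sigma_a)) = <z, l>. *)
Lemma kernel_first_order l z :
  \sum_(i <- None :: map Some Phip) first_order_coef i *
    ((F (n.+1%:R^-1 *: first_order_node l i) z - 1) / n.+1%:R^-1)
  @[n --> \oo] --> dot z l.
Proof.
pose u x (s : R) := F (s *: x) z.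
have du x s : derivable (u x) s 1 by exact: (kernel_derivable dk).
have u0 x : u x 0 = 1 by rewrite /u scale0r (kernel0l dk).
pose step n : R := n.+1%:R^-1.
have step0 n : 0 < step n by rewrite invr_gt0 ltr0n.
have step_cvg : step n @[n --> \oo] --> (0 : R) by exact: cvg_harmonic.
have quo x (x_ : nat -> R) : x_ n @[n --> \oo] --> (0 : R) -> (forall n, x_ n != 0) ->
    (u x (x_ n) - 1) / x_ n @[n --> \oo] --> 'D_1 (u x) 0.
  by move=> xc x0; have := derivable_cvg_quotient (du x 0) xc x0; rewrite u0.
(* These are the quotients [(u l s - u (l sigma_a) s) / s] of the ray equation, with 1 subtracted
   from both terms so that each converges separately. *)
pose W (x_ : nat -> R) n := \sum_(a <- Phip) k a *
  ((u l (x_ n) - 1) / x_ n - (u (l *m reflection a) (x_ n) - 1) / x_ n).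
pose Winf := \sum_(a <- Phip) k a * ('D_1 (u l) 0 - 'D_1 (u (l *m reflection a)) 0).
have Wcvg (x_ : nat -> R) : x_ n @[n --> \oo] --> (0 : R) -> (forall n, x_ n != 0) ->
    W x_ n @[n --> \oo] --> Winf.
  move=> xc x0; rewrite /W /Winf; elim: (enum_fset Phip) => [|a s ih].
    rewrite big_nil (_ : (fun n => _) = cst 0); first exact: cvg_cst.
    by apply/funext => n; rewrite big_nil.
  rewrite big_cons (_ : (fun n => _) = (fun n => k a *
    ((u l (x_ n) - 1) / x_ n - (u (l *m reflection a) (x_ n) - 1) / x_ n) +
    \sum_(a <- s) k a *
    ((u l (x_ n) - 1) / x_ n - (u (l *m reflection a) (x_ n) - 1) / x_ n))); last first.
    by apply/funext => n; rewrite big_cons.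
  exact: (cvgD (cvgM (cvg_cst (k a)) (cvgB (quo _ _ xc x0) (quo _ _ xc x0))) ih).
(* The ray equation is singular at 0. It is evaluated at mean value points [c n], where the
   derivative equals a difference quotient, and both sides pass to the limit. *)
have DE : 'D_1 (u l) 0 = dot l z - Winf.
  have mvt n : exists2 c, 0 < c < step n &
      (u l (step n) - 1) / step n = 'D_1 (u l) c.
    have [c||c] := @MVT _ (u l) (fun s => 'D_1 (u l) s) _ _ (step0 n).
    - by move=> _; split.
    - by apply: derivable_within_continuous => s _.
    rewrite in_itv/= => c0; rewrite u0 subr0 => ->; exists c => //.
    by rewrite mulfK// gt_eqF.
  pose c n := s2val (cid2 (mvt n)).
  have cb n : 0 < c n < step n by exact: (s2valP (cid2 (mvt n))).
  have cE n : (u l (step n) - 1) / step n = 'D_1 (u l) (c n) by exact: (s2valP' (cid2 (mvt n))).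
  have c0 n : c n != 0 by have /andP[/lt0r_neq0] := cb n.
  have ccvg : c n @[n --> \oo] --> (0 : R).
    apply: (@squeeze_cvgr _ _ _ _ (cst 0) step) => //; last exact: cvg_cst.
    by apply: nearW => n; have /andP[/ltW -> /ltW ->] := cb n.
  have h1 : 'D_1 (u l) (c n) @[n --> \oo] --> 'D_1 (u l) 0.
    have := quo l step step_cvg (fun n => lt0r_neq0 (step0 n)).
    by under eq_fun do rewrite cE.
  have h2 : 'D_1 (u l) (c n) @[n --> \oo] --> dot l z - Winf.
    rewrite (_ : (fun n => _) = (fun n => dot l z * u l (c n) - W c n)); last first.
      apply/funext => n.
      have [_ ->] := kernel_ray_derive dk l z (c0 n); congr (_ - _).
      rewrite mulr_sumr; apply: eq_bigr => a _; rewrite /u; ring.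
    rewrite -[dot l z in X in _ --> X]mulr1; apply: cvgB; last exact: Wcvg.
    have cu : {for (0 : R), continuous (u l)}.
      by apply: differentiable_continuous; apply/derivable1_diffP.
    rewrite -(u0 l); exact: (cvgM (cvg_cst (dot l z)) (cvg_comp _ _ ccvg cu)).
  exact: (cvg_unique _ h1 h2).
rewrite (_ : (fun n => _) = (fun n => (u l (step n) - 1) / step n + W step n)); last first.
  apply/funext => n; rewrite big_cons big_map/= mulrDl mul1r -addrA; congr (_ + _).
  rewrite /W /gamma mulr_suml -big_split; apply: eq_bigr => a _ /=.
  by rewrite mulrBr mulNr.
rewrite dotC (_ : dot l z = 'D_1 (u l) 0 + Winf); last by rewrite DE subrK.
apply: cvgD; first by apply: quo => // n; rewrite gt_eqF.
by apply: Wcvg => // n; rewrite gt_eqF.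
Qed.

End kernel_first_order.

(** * From concentration of the transition law to convergence in probability *)

Section process_law.
Variables (R : realType) (N : nat) (S : set 'rV[R]_N).
Variables (p : R -> 'rV[R]_N -> 'rV[R]_N -> R).
Variables (d : measure_display) (Omega : measurableType d) (P : probability Omega R).
Variables (X : R -> Omega -> 'rV[R]_N) (x : 'rV[R]_N).
Hypothesis mS : measurable S.
Hypothesis XP : feller_process S p P X x.

(* The Markov property at time 0, conditioned on the event [X 0 = x]. *)
Lemma process_law t A : 0 < t -> measurable A -> A `<=` S ->
  P (X t @^-1` A) = transition p t x A.
Proof.
move=> t0 mA AS; pose B := X 0 @^-1` [set x].
have m1 : measurable [set x].
  rewrite -[X in measurable X]setCK; apply: measurableC.
  apply: open_measurable_rV; rewrite openC; apply: accessible_closed_set1.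
  exact: hausdorff_accessible (@norm_hausdorff _ _).
have mX s : 0 <= s -> forall C, measurable C -> measurable (X s @^-1` C).
  move=> s0 C mC; rewrite -[X in measurable X]setTI.
  exact: (process_measurable XP s0).
have mB : measurable B by exact: mX.
have PB' : P (~` B) = 0%E.
  have /negligibleP : P.-negligible (~` B) by exact: (process_start XP).
  by apply; exact: measurableC.
have PB : P B = 1%E.
  by rewrite -[B]setCK probability_setC ?PB' ?sube0//; exact: measurableC.
have pB : past X 0 B.
  apply: sub_sigma_algebra; exists 0 => /=; first by rewrite in_itv/= lexx.
  by exists [set x].
have := process_markov XP (lexx 0) t0 mA AS pB.
rewrite add0r (eq_integral (cst (transition p t x A))); last first.
  by move=> w /set_mem /= ->.
rewrite integral_cst//. rewrite [X in (_ * X)%E]PB mule1 => <-.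
have mXA : measurable (X t @^-1` A) by apply: mX mA; exact: ltW.
transitivity (P (X t @^-1` A `\` B) + P (X t @^-1` A `&` B))%E.
  exact: (measureDI P mXA mB).
rewrite setIC -[RHS]add0e; congr (_ + _)%E.
apply/eqP; rewrite -measure_le0 -PB'; apply: le_measure; rewrite ?inE.
- exact: measurableD.
- exact: measurableC.
- by move=> w [].
Qed.

Lemma cvg_in_probability_of_concentration (l : 'rV[R]_N) : S x ->
  (forall e eta, 0 < e -> 0 < eta -> \forall t \near +oo,
    ((1 - eta)%:E <=
     \int[lebesgue_rV R N]_(y in S) (near_drift l e t y * p t x y)%:E)%E) ->
  cvg_in_probability P (fun t w => t^-1 *: X t w) l.
Proof.
move=> Sx conc e e0.
pose C t := [set y : 'rV[R]_N | enorm (t^-1 *: y - l) <= e].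
have mC t : measurable (C t).
  rewrite (_ : C t = (fun y => enorm (t^-1 *: y - l)) @^-1` `]-oo, e]); last first.
    by apply/seteqP; split => y; rewrite /C/= in_itv.
  rewrite -[X in measurable X]setTI.
  apply: continuous_measurable_rV => // y.
  apply: (@continuous_comp _ _ _ (fun y => t^-1 *: y - l) (@enorm R N)).
    apply: (@continuous_comp _ _ _ (fun y => t^-1 *: y) (fun y => y - l)).
      exact: scaler_continuous.
    exact: (cvgB cvg_id (cvg_cst l)).
  exact: continuous_enorm.
have mX t : 0 < t -> measurable (X t @^-1` (S `&` C t)).
  move=> t0; rewrite -[X in measurable X]setTI.
  by apply: (process_measurable XP (ltW t0)) => //; exact: measurableI.
(* Since [X t] stays in [S], the event is the complement of [X t] lying in [S] and near the
   drift. *)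
have PE t : 0 < t ->
    P [set w | e < enorm (t^-1 *: X t w - l)] = (1 - P (X t @^-1` (S `&` C t)))%E.
  move=> t0; rewrite -probability_setC; last exact: mX.
  congr (P _); apply/seteqP; split => w /=.
    by rewrite ltNge => /negP h [_].
  move=> h; rewrite ltNge; apply/negP => h'; apply: h; split => //.
  by apply: (process_state XP); rewrite ltW.
apply: cvg_EFin.
  near=> t; have t0 : 0 < t by near: t; exact: nbhs_pinfty_gt (num_real _).
  by rewrite PE// fin_numB fin_num_measure//; exact: mX.
apply/cvgrPdist_le => eta eta0; near=> t.
have t0 : 0 < t by near: t; exact: nbhs_pinfty_gt (num_real _).
have mA : measurable (S `&` C t) by exact: measurableI.
have AS : S `&` C t `<=` S by move=> y [].
have PA : ((1 - eta)%:E <= P (X t @^-1` (S `&` C t)))%E.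
  rewrite process_law// /transition integral_mkcondr.
  rewrite (_ : (\int[_]_(y in S) _)%E =
      (\int[lebesgue_rV R N]_(y in S) (near_drift l e t y * p t x y)%:E)%E).
    by near: t; exact: conc.
  apply: eq_integral => y _; rewrite patchE /near_drift.
  rewrite (_ : (y \in C t) = (enorm (t^-1 *: y - l) <= e)); last first.
    by apply/idP/idP => [/set_mem|/mem_set].
  by case: (_ <= e); rewrite ?mul1r ?mul0r.
rewrite sub0r normrN /= PE//.
have : P (X t @^-1` (S `&` C t)) \is a fin_num by exact: fin_num_measure (mX t t0).
move: PA (probability_le1 P (mX t t0)); case: (P _) => [u| |]//.
by rewrite !lee_fin -EFinB/= => u1 u2 _; rewrite ger0_norm; lra.
Unshelve. all: by end_near. Qed.

End process_law.

Lemma measurable_weyl_chamber (R : realType) (N : nat) (Phip : {fset 'rV[R]_N}) :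
  measurable (weyl_chamber Phip).
Proof.
rewrite (_ : weyl_chamber Phip =
    \bigcap_(a in [set` Phip]) ((fun x => dot x a) @^-1` `[0, +oo[)).
  apply: fin_bigcap_measurable => // a _.
  rewrite -[X in measurable X]setTI.
  by apply: continuous_measurable_rV => //; exact: continuous_dotl.
by apply/seteqP; split => x h a aP; have := h a aP; rewrite /= in_itv/= andbT.
Qed.

Lemma dunkl_constant_ge0 (R : realType) (N : nat) (Phip : {fset 'rV[R]_N})
  (k : 'rV[R]_N -> R) : 0 <= dunkl_constant Phip k.
Proof.
rewrite /dunkl_constant invr_ge0 fine_ge0//; apply: integral_ge0 => y _.
by rewrite lee_fin mulr_ge0 ?expR_ge0 ?weight_ge0.
Qed.

(** * Convergence of the Dunkl and Bessel processes *)

Unset Implicit Arguments. Set Strict Implicit. Set Printing Implicit Defensive.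

Theorem corollary1p8 (R : realType) (N : nat) (N_ge1 : (1 <= N)%N)
    (Phi Phip : {fset 'rV[R]_N}) (k : 'rV[R]_N -> R)
    (E : 'rV[R[i]]_N -> 'rV[R[i]]_N -> R[i])
    (d : measure_display) (Omega : measurableType d) (P : probability Omega R)
    (X : R -> Omega -> 'rV[R]_N) (l x : 'rV[R]_N) :
  root_system Phi -> positive_subsystem Phi Phip -> multiplicity Phi k ->
  is_dunkl_kernel Phip k E -> regular Phi l ->
  dunkl_process Phip k E P l x X \/
  [/\ weyl_chamber Phip l, weyl_chamber Phip x &
      bessel_process Phi Phip k E P l x X] ->
  cvg_in_probability P (fun t w => t^-1 *: X t w) l.
Proof.
move=> rs ps mk dk _ [[XP _]|[Cl Cx [XP _]]].
  have F_cont : continuous (on_reals E ^~ l).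
    by apply: continuous_on_reals; case: (dk (cplx l)) => -[].
  have F_total := transition_total (process_semigroup XP).
  apply: (cvg_in_probability_of_concentration measurableT XP) => // e eta e0 eta0.
  apply: (drift_concentration measurableT _ (dunkl_constant_ge0 Phip k)) => //.
  - exact: (kernelZ rs ps mk dk).
  - exact: (kernel_ge0 rs ps mk dk).
  - exact: (kernel_dist rs ps mk dk).
  (* The state space is all of R^N, so every node of the first-order expansion is an admissible
     starting point. *)
  apply: (concentration_of_first_moment measurableT _ (dunkl_constant_ge0 Phip k)
    _ _ _ _ _ _ _ (@kernel_first_order _ _ _ _ _ dk l)) => //.
  - exact: (kernel0l dk).
  - exact: (kernelZ rs ps mk dk).
  - exact: (kernel_ge0 rs ps mk dk).
  - exact: (kernel_dist rs ps mk dk).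
have mC := measurable_weyl_chamber Phip.
have C0 : weyl_chamber Phip 0 by move=> a _; rewrite dot0l.
have J_total := transition_total (process_semigroup XP).
have c0 : 0 <= #|` fset_set (weyl_group Phi)|%:R * dunkl_constant Phip k.
  by rewrite mulr_ge0 ?ler0n// dunkl_constant_ge0.
apply: (cvg_in_probability_of_concentration mC XP) => // e eta e0 eta0.
apply: (drift_concentration mC C0 c0) => //.
- exact: (besselZ rs ps mk dk).
- exact: (bessel_ge0 rs ps mk dk).
- exact: (bessel_dist rs ps mk dk).
- exact: (continuous_bessel dk).
(* The chamber is a cone on which [<y, l>] dominates every [<y g, l>], which gives the exponential
   moment. *)
apply: (concentration_of_radial_growth mC C0 c0) => //.
- exact: (bessel0l rs dk).
- exact: (besselZ rs ps mk dk).
- exact: (bessel_ge0 rs ps mk dk).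
- exact: (bessel_dist rs ps mk dk).
- exact: (continuous_bessel dk).
- by move=> b y b0 Cy a aP; rewrite dotZl mulr_ge0 ?Cy// ltW.
- by move=> s y Cy s1; exact: (bessel_radial_growth rs ps mk dk).
Qed.
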